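(* Let $\mathbb{X}$ be a finite set of points in $\mathbb{P}^{n_1}\times\cdots\times\mathbb{P}^{n_r}$, and suppose that $\mathbb{X}$ is ACM. Let $P\in\mathbb{X}$, and suppose that $\deg_{\mathbb{X}}(P)=\underline{\alpha}=(\alpha_1,\ldots,\alpha_r)$. Let \[0\rightarrow \mathbb{F}_t=\bigoplus_{\underline{i}\in S_t}R(-\underline{i})\rightarrow\cdots\rightarrow\mathbb{F}_1\rightarrow R\rightarrow R/I_{\mathbb{X}}\rightarrow0\] be the minimal $\mathbb{N}^r$-graded free resolution of $R/I_{\mathbb{X}}$, where $t=\sum_{i=1}^r n_i$. Let $\mathbb{Y}=\mathbb{X}\setminus\{P\}$. (i) If $\mathbb{Y}$ is ACM, then $(\alpha_1+n_1,\ldots,\alpha_r+n_r)\in S_t$; that is, $\deg_{\mathbb{X}}(P)+(n_1,\ldots,n_r)$ appears as a shift in the last free $R$-module. (ii) If $\mathbb{Y}$ is not ACM, then $\operatorname{depth}(R/I_{\mathbb{Y}})=r-1$.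
   Context: Let $k$ be an algebraically closed field of characteristic zero, let $r,n_1,\ldots,n_r$ be positive integers, $\mathbb{N}=\{0,1,2,\ldots\}$, and let $R=k[x_{1,0},\ldots,x_{1,n_1},\ldots,x_{r,0},\ldots,x_{r,n_r}]$ be $\mathbb{N}^r$-graded by $\deg x_{i,j}=e_i$, the $i$th standard basis vector of $\mathbb{N}^r$. For a finite set of points $\mathbb{X}$ in $\mathbb{P}^{n_1}\times\cdots\times\mathbb{P}^{n_r}$ (over $k$), $I_{\mathbb{X}}\subseteq R$ is the multihomogeneous ideal generated by the multihomogeneous forms vanishing at all points of $\mathbb{X}$ (so $I_{\emptyset}=R$). For nonempty $\mathbb{X}$ one has $\dim R/I_{\mathbb{X}}=r$; $\mathbb{X}$ is arithmetically Cohen–Macaulay (ACM) if $\operatorname{depth}R/I_{\mathbb{X}}=r$. The empty set is regarded as ACM. Order $\mathbb{N}^r$ by $(i_1,\ldots,i_r)\succeq(j_1,\ldots,j_r)$ iff $i_t\ge j_t$ for all $t$. For $P\in\mathbb{X}$, a multihomogeneous form $F\in R$ is a separator for $P$ if $F(P)\neq0$ and $F(Q)=0$ for all $Q\in\mathbb{X}\setminus\{P\}$. The degree of $P\in\mathbb{X}$ is the set $\deg_{\mathbb{X}}(P)$ of minimal elements of $\{\deg F : F\text{ is a separator for }P\in\mathbb{X}\}\subseteq\mathbb{N}^r$. It is known that if $\mathbb{X}$ is ACM then $|\deg_{\mathbb{X}}(P)|=1$ for every $P\in\mathbb{X}$; in that case one writes $\deg_{\mathbb{X}}(P)=\underline{\alpha}$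 instead of $\{\underline{\alpha}\}$. $S_t$ is the multiset of multidegree shifts of $\mathbb{F}_t$. *)

(* Defs.v *)
From HB Require Import structures.
From mathcomp Require Import all_boot all_order all_algebra.
From mathcomp Require Import finmap.
From mathcomp Require Import mpoly.

Set Implicit Arguments.
Unset Strict Implicit.
Unset Printing Implicit Defensive.

Import GRing.Theory.
Local Open Scope ring_scope.

Section Ideals.
Variable A : comNzRingType.

Definition gen_ideal (G : A -> Prop) (f : A) : Prop :=
  exists2 s : seq (A * A),
    {in s, forall p, G p.2} & f = \sum_(p <- s) p.1 * p.2.

Definition add_gens (I : A -> Prop) (s : seq A) : A -> Prop :=
  gen_ideal (fun f => I f \/ f \in s).

(* [s] is a sequence of elements of [m] that is regular on [A / I]; the last
   clause says that [A / (I + (s))] is not zero. *)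
Definition regular_seq (m I : A -> Prop) (s : seq A) : Prop :=
  [/\ {in s, forall f, m f},
      forall j : nat, (j < size s)%N -> forall g : A,
        add_gens I (take j s) (g * s`_j) -> add_gens I (take j s) g
    & ~ add_gens I s 1].

(* The depth of [A / I] with respect to [m] is [e]. *)
Definition has_depth (m I : A -> Prop) (e : nat) : Prop :=
  (exists2 s : seq A, regular_seq m I s & size s = e) /\
  (forall s : seq A, regular_seq m I s -> (size s <= e)%N).

End Ideals.

(* Multidegrees in N^r are represented by ['X_{1..r}], whose order [(_ <= _)%MM]
   and addition [(_ + _)%MM] are the componentwise ones. *)

Section MultiProjective.
Variables (k : fieldType) (r : nat) (n : 'I_r -> nat).

(* [Tagged _ j] with tag [i] is the index of the variable x_{i,j}. *)
Definition mvar : finType := {i : 'I_r & 'I_(n i).+1}.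

Definition mvar_rank (i : 'I_r) (j : 'I_(n i).+1) : 'I_#|mvar| :=
  enum_rank (Tagged (fun i => 'I_(n i).+1) j : mvar).

Definition mring := {mpoly k[#|mvar|]}.

Definition irrelevant : mring -> Prop :=
  gen_ideal (fun f : mring => exists l : 'I_#|mvar|, f = 'X_l).

Definition multideg (m : 'X_{1..#|mvar|}) : 'X_{1..r} :=
  [multinom \sum_(j < (n i).+1) m (mvar_rank j) | i < r].

(* The zero form has every multidegree. *)
Definition multihomog (a : 'X_{1..r}) (f : mring) : Prop :=
  {in msupp f, forall m, multideg m = a}.

(* Projective space as the set of lines of k^(m+1). *)
Definition proj (m : nat) := {L : {vspace 'rV[k]_m.+1} | \dim L == 1%N}.

Definition mproj := {dffun forall i : 'I_r, proj (n i)}.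

Definition is_rep (P : mproj) (v : forall i : 'I_r, 'rV[k]_(n i).+1) : Prop :=
  forall i, v i != 0 /\ v i \in val (P i).

Definition eval_at (f : mring) (v : forall i : 'I_r, 'rV[k]_(n i).+1) : k :=
  f.@[fun l => let x := enum_val l : mvar in v (tag x) ord0 (tagged x)].

(* For multihomogeneous [f], "for every" and "for some" system of homogeneous
   coordinates of [P] are the same; hence [~ vanishes_at f P] is f(P) <> 0. *)
Definition vanishes_at (f : mring) (P : mproj) : Prop :=
  forall v, is_rep P v -> eval_at f v = 0.

Definition point_ideal (X : {fset mproj}) : mring -> Prop :=
  gen_ideal (fun f : mring =>
    (exists a, multihomog a f) /\ {in X, forall Q, vanishes_at f Q}).

Definition is_ACM (X : {fset mproj}) : Prop :=
  X = fset0 \/ has_depth irrelevant (point_ideal X) r.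

Definition separator (X : {fset mproj}) (P : mproj) (a : 'X_{1..r})
    (f : mring) : Prop :=
  [/\ multihomog a f, ~ vanishes_at f P
    & {in (X `\ P)%fset, forall Q, vanishes_at f Q}].

Definition separator_deg (X : {fset mproj}) (P : mproj) (a : 'X_{1..r}) : Prop :=
  exists f, separator X P a f.

Definition deg_point (X : {fset mproj}) (P : mproj) (a : 'X_{1..r}) : Prop :=
  separator_deg X P a /\
  (forall b, separator_deg X P b -> (b <= a)%MM -> b = a).

(* The minimal graded free resolution
     0 -> F_t -> ... -> F_1 -> F_0 = R -> R/I -> 0
   with F_s the direct sum of the R(-a) for a in the list [S s].  Elements of
   F_s are row vectors, and F_(s+1) -> F_s is [v |-> v *m d s].  As [S 0] has
   size 1, [const_mx f] is the element f of F_0 = R. *)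
Record min_graded_free_resolution (I : mring -> Prop) (t : nat)
    (S : nat -> seq 'X_{1..r})
    (d : forall s, 'M[mring]_(size (S s.+1), size (S s))) : Prop := {
  res_start : S 0%N = [:: 0%MM];
  res_end : forall s, (t < s)%N -> S s = [::];
  (* the maps have degree 0; no condition on zero entries *)
  res_graded : forall s i j, {in msupp (d s i j), forall m,
    (multideg m + nth 0%MM (S s) j)%MM = nth 0%MM (S s.+1) i};
  res_minimal : forall s i j, irrelevant (d s i j);
  res_exact0 : forall f : mring,
    I f <-> exists u : 'rV[mring]_(size (S 1%N)), u *m d 0%N = const_mx f;
  res_exact : forall s (v : 'rV[mring]_(size (S s.+1))),
    v *m d s = 0 <-> exists u : 'rV[mring]_(size (S s.+2)), u *m d s.+1 = v
}.

End MultiProjective.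

Arguments irrelevant {k r n}.

(* Main.v *)
Require Import Defs.
From HB Require Import structures.
From mathcomp Require Import all_boot all_order all_algebra.
From mathcomp Require Import finmap.
From mathcomp Require Import mpoly.
From mathcomp Require Import ring zify.
From Stdlib Require Import Classical ClassicalEpsilon.

Set Implicit Arguments.
Unset Strict Implicit.
Unset Printing Implicit Defensive.

Import Order.TTheory GRing.Theory.
Local Open Scope ring_scope.

(** Write t = n_1 + ... + n_r, so that R has N = t + r variables, let F be a
    separator of P in degree alpha, and Y = X \ P.  Since alpha is the only
    minimal degree of a separator, restriction to the cone over P (on which the
    multihomogeneous forms become multiples of monomials in r variables) shows that
    I_Y = I_X + (F), while I_X : F = I_P.  Hence there is an exact sequence
       0 -> R/I_P (- alpha) -> R/I_X -> R/I_Y -> 0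
    given by [separator_colon] and [separator_adjoin], whose first term is a
    polynomial ring in r variables up to a shift, hence of depth r.

    Depth is read off the Koszul homology of the variables of R.  If A/I has a
    regular sequence of length e, then its Koszul homology vanishes in the
    degrees above N - e ([acyclic_wreg]); conversely, over a Noetherian ring,
    such vanishing produces a regular sequence of length e
    ([acyclic_regular]), through prime avoidance ([nzdiv_exists]).  That R is
    Noetherian follows from Dickson's lemma ([noetherian_mpoly]).

    For (ii), the long exact sequence of Koszul homology ([acyclic_adjoin])
    gives a regular sequence of length r - 1 on R/I_Y.  No regular sequence
    on R/I_Y is longer than r ([regular_bound]): the D^e monomials with
    exponents below D in a regular sequence of length e are linearly
    independent modulo I_Y and of degree O(D), while R/I_Y embeds into a
    finite product of polynomial rings in r variables, where polynomials of
    degree O(D) span a space of dimension O(D^r).  So if Y is not ACM, the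
    depth is r - 1.

    For (i), let z be the exterior product of t independent linear forms that
    generate I_P.  It is a Koszul cycle modulo I_P, of multidegree
    (n_1, ..., n_r), whose coefficients are constants, so its class is not
    zero.  If Y is ACM, then H_(t+1) (R/I_Y) = 0, hence the class of F z in
    H_t (R/I_X) is not zero either ([boundary_descent]).  This class has
    multidegree alpha + (n_1, ..., n_r), and H_t (R/I_X) is Tor_t (R/I_X, k),
    whose degrees are the shifts of F_t.  The comparison of the two ways to
    compute Tor is the diagram chase [resolution_chase]. *)

(** * Ideals, regular sequences and nonzero divisors *)
Section CommutativeAlgebra.
Variable A : comNzRingType.
Implicit Types (I J Q : A -> Prop) (s : seq A).

Record ideal I : Prop := Ideal {
  ideal0 : I 0;
  idealD : forall a b, I a -> I b -> I (a + b);
  idealM : forall c a, I a -> I (c * a) }.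

Lemma ideal_mulr I : ideal I -> forall c a, I a -> I (a * c).
Proof. by move=> hI c a Ia; rewrite mulrC; apply: idealM. Qed.

Lemma idealN I : ideal I -> forall a, I a -> I (- a).
Proof. by move=> hI a Ia; rewrite -mulN1r; apply: idealM. Qed.

Lemma idealB I : ideal I -> forall a b, I a -> I b -> I (a - b).
Proof. by move=> hI a b Ia Ib; apply: idealD => //; apply: idealN. Qed.

Lemma ideal_sum I (T : Type) (r : seq T) (p : pred T) (F : T -> A) :
  ideal I -> (forall i, p i -> I (F i)) -> I (\sum_(i <- r | p i) F i).
Proof.
move=> hI IF; elim/big_rec: _ => [|i x pi Ix]; first exact: ideal0.
by apply: idealD => //; apply: IF.
Qed.

Lemma ideal_sub_trans I a b : ideal I -> I (a - b) -> I b -> I a.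
Proof. by move=> hI Iab Ib; rewrite -(subrK b a); apply: idealD. Qed.

(** I + (f), written with one coefficient of f so that the quotient by a
    sequence can be taken one element at a time. *)
Definition adjoin I (f : A) : A -> Prop := fun g => exists a, I (g - a * f).

Lemma adjoin_ideal I f : ideal I -> ideal (adjoin I f).
Proof.
move=> hI; split.
- by exists 0; rewrite mul0r subr0; apply: ideal0.
- move=> a b [x Ix] [y Iy]; exists (x + y).
  have -> : a + b - (x + y) * f = (a - x * f) + (b - y * f) by ring.
  exact: idealD.
- move=> c a [x Ix]; exists (c * x).
  have -> : c * a - c * x * f = c * (a - x * f) by ring.
  exact: idealM.
Qed.

Lemma adjoin_sub I f g : I g -> adjoin I f g.
Proof. by move=> Ig; exists 0; rewrite mul0r subr0. Qed.

Lemma adjoin_gen I f a : ideal I -> adjoin I f (a * f).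
Proof. by move=> hI; exists a; rewrite subrr; apply: ideal0. Qed.

Lemma gen_ideal_ideal (G : A -> Prop) : ideal (gen_ideal G).
Proof.
split.
- by exists [::] => //; rewrite big_nil.
- move=> a b [s Gs ->] [s' Gs' ->]; exists (s ++ s'); last by rewrite big_cat.
  by move=> p; rewrite mem_cat => /orP [/Gs|/Gs'].
- move=> c a [s Gs ->]; exists [seq (c * p.1, p.2) | p <- s].
    by move=> p /mapP [q qs ->] /=; apply: Gs.
  by rewrite big_map mulr_sumr; apply: eq_bigr => p _ /=; rewrite mulrA.
Qed.

Lemma gen_ideal_sub (G : A -> Prop) f : G f -> gen_ideal G f.
Proof.
move=> Gf; exists [:: (1, f)]; last by rewrite big_seq1 mul1r.
by move=> p; rewrite inE => /eqP ->.
Qed.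

Lemma gen_ideal_min (G I : A -> Prop) :
  ideal I -> (forall f, G f -> I f) -> forall f, gen_ideal G f -> I f.
Proof.
move=> hI GI f [s Gs ->]; rewrite big_seq; apply: ideal_sum => // p ps.
by apply: idealM => //; apply: GI; apply: Gs.
Qed.

Lemma add_gens_ideal I s : ideal (add_gens I s).
Proof. exact: gen_ideal_ideal. Qed.

Lemma add_gens_nil I f : ideal I -> add_gens I [::] f <-> I f.
Proof.
move=> hI; split; last by move=> If; apply: gen_ideal_sub; left.
by apply: gen_ideal_min => // g [].
Qed.

Lemma add_gens_cons I f s g :
  ideal I -> add_gens I (f :: s) g <-> add_gens (adjoin I f) s g.
Proof.
move=> hI; split; apply: gen_ideal_min; try exact: add_gens_ideal.
- move=> h [Ih|]; first by apply: gen_ideal_sub; left; apply: adjoin_sub.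
  rewrite inE => /orP [/eqP ->|hs]; last by apply: gen_ideal_sub; right.
  by apply: gen_ideal_sub; left; rewrite -{2}[f]mul1r; apply: adjoin_gen.
- have hJ := add_gens_ideal I (f :: s).
  move=> h [[a Ih]|hs].
    apply: (ideal_sub_trans hJ (gen_ideal_sub (or_introl Ih))).
    by apply: (idealM hJ); apply: gen_ideal_sub; right; rewrite mem_head.
  by apply: gen_ideal_sub; right; rewrite inE hs orbT.
Qed.

Lemma adjoin_ext I J f :
  (forall g, I g <-> J g) -> forall g, adjoin I f g <-> adjoin J f g.
Proof. by move=> IJ g; split=> -[a /IJ h]; exists a. Qed.

Definition nzdiv I f := forall g, I (g * f) -> I g.

(** Weak regularity: the quotient of A / I by [s] is allowed to vanish. *)
Fixpoint wreg s I : Prop :=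
  if s is f :: s' then nzdiv I f /\ wreg s' (adjoin I f) else True.

Lemma wreg_ext s I J : (forall g, I g <-> J g) -> wreg s I -> wreg s J.
Proof.
elim: s I J => //= f s IHs I J IJ [fI sI]; split.
  by move=> g /IJ /fI /IJ.
by apply: IHs sI; apply: adjoin_ext.
Qed.

Lemma regular_seqP m I s : ideal I ->
  regular_seq m I s <->
  [/\ {in s, forall f, m f}, wreg s I & ~ add_gens I s 1].
Proof.
move=> hI; suff wregP : wreg s I <-> (forall j : nat, (j < size s)%N ->
    forall g : A, add_gens I (take j s) (g * s`_j) -> add_gens I (take j s) g).
  by split=> -[ms /wregP h n1]; split.
elim: s I hI => [|f s IHs] I hI; first by split.
have hJ := adjoin_ideal f hI; split=> [[fI sI] [_ g|j js g]|reg] /=.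
- by move/(add_gens_nil _ hI)/fI => Ig; apply/add_gens_nil.
- by move/(add_gens_cons _ _ _ hI)/(proj1 (IHs _ hJ) sI j js) => ?;
    apply/add_gens_cons.
- split; first by move=> g Ig; move: (reg 0%N isT g) => /=;
    rewrite !add_gens_nil //; apply.
  apply/(IHs _ hJ) => j js g h; have := reg j.+1 js g; rewrite /= !add_gens_cons //.
  by apply.
Qed.

Definition noetherian := forall J, ideal J ->
  exists2 s : seq A, {in s, forall f, J f} & forall f, J f -> gen_ideal (fun g => g \in s) f.

(** A family of ideals without a maximal member contains a strictly increasing
    sequence, whose union is an ideal that no finite set generates. *)
Lemma noetherian_max (T : Type) (F : T -> A -> Prop) (t0 : T) :
  noetherian -> (forall t, ideal (F t)) ->
  exists t, forall t', (forall f, F t f -> F t' f) -> forall f, F t' f -> F t f.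
Proof.
move=> nA hF; apply: NNPP => nomax.
have grow t : {t' | (forall f, F t f -> F t' f) & exists2 f, F t' f & ~ F t f}.
  have h : exists t', (forall f, F t f -> F t' f) /\ exists2 f, F t' f & ~ F t f.
    apply: NNPP => no; apply: nomax; exists t => t' tt' f Ft'f.
    by apply: NNPP => nFf; apply: no; exists t'; split=> //; exists f.
  by have [t' [? ?]] := constructive_indefinite_description _ h; exists t'.
pose u := nat_rect (fun _ => T) t0 (fun _ t => s2val (grow t)).
have uS i f : F (u i) f -> F (u i.+1) f by exact: (s2valP (grow (u i))).
have ule i j f : (i <= j)%N -> F (u i) f -> F (u j) f.
  by move=> ij; rewrite -(subnKC ij); elim: (j - i)%N => [|d IH];
    rewrite ?addn0 // addnS => /IH /uS.
have hU : ideal (fun f => exists i, F (u i) f).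
  split; first by exists 0%N; apply: ideal0.
  - move=> a b [i ia] [j jb]; exists (maxn i j).
    by apply: (idealD (hF _)); [apply: ule ia|apply: ule jb];
      rewrite ?leq_maxl ?leq_maxr.
  - by move=> c a [i ia]; exists i; apply: (idealM (hF _)).
have [s sU Us] := nA _ hU.
have [n sn] : exists n, {in s, forall f, F (u n) f}.
  elim: s sU {Us} => [|f s IHs] sU; first by exists 0%N.
  have [n sn] := IHs (fun g gs => sU g (@mem_behead _ (f :: s) g gs)).
  have [i fi] := sU f (mem_head _ _); exists (maxn i n) => g.
  rewrite inE => /orP [/eqP ->|/sn]; first by apply: ule fi; rewrite leq_maxl.
  by apply: ule; rewrite leq_maxr.
have [f t'f nf] := s2valP' (grow (u n)).
have Uf : exists i, F (u i) f by exists n.+1.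
by apply: nf; apply: (gen_ideal_min (hF _) sn) (Us _ Uf).
Qed.

(** Prime avoidance, for primes none of which contains another properly:
    from a in m outside the first primes but inside p, adding an element of m
    that lies in the first primes but not in p gives one outside all. *)
Lemma prime_avoidance (T : Type) (p : T -> A -> Prop) (m : A -> Prop) (s : seq T) :
  ideal m -> (forall t, ideal (p t)) ->
  (forall t a b, p t (a * b) -> p t a \/ p t b) ->
  (forall t, exists2 a, m a & ~ p t a) ->
  (forall t t', (forall a, p t a -> p t' a) -> forall a, p t' a -> p t a) ->
  exists2 a, m a & forall t, List.In t s -> ~ p t a.
Proof.
move=> hm hp pr mp pmax; elim: s => [|t s [a ma aP]] /=.
  by exists 0 => //; apply: ideal0.
case: (classic (p t a)) => [pta|npta]; last first.
  by exists a => // t' [<- //|]; apply: aP.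
have npr1 : ~ p t 1.
  by have [b _ nb] := mp t => p1; apply: nb; rewrite -[b]mulr1; apply: (idealM (hp t)).
have [b mb [nptb bP]] : exists2 b, m b &
    ~ p t b /\ forall t', List.In t' s -> p t' b.
  suff [c nc cP] : exists2 c, ~ p t c & forall t', List.In t' s -> p t' c.
    have [d md nd] := mp t; exists (d * c); first exact: ideal_mulr.
    by split=> [/pr []|t' /cP ?] //; apply: (idealM (hp t')).
  elim: s aP => [|t' s IHs] aP; first by exists 1.
  have [c nc cP] := IHs (fun t1 h => aP t1 (or_intror h)).
  have [d dt' ndt] : exists2 d, p t' d & ~ p t d.
    apply: NNPP => no; apply: (aP t' (or_introl erefl)).
    apply: pmax pta => d pd; apply: NNPP => nd; apply: no; by exists d.
  exists (c * d); first by case/pr.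
  move=> t1 [<-|/cP ?]; first exact: (idealM (hp t')).
  exact: (ideal_mulr (hp t1)).
exists (a + b); first exact: idealD.
move=> t' [<-|t's] pab.
  by apply: nptb; rewrite -(addKr a b) addrC; apply: (idealB (hp t)).
by apply: (aP t') => //; rewrite -(addrK b a); apply: (idealB (hp t')) => //; apply: bP.
Qed.

(** The maximal ideals among the annihilators of nonzero elements of A / I are
    prime and contain all zero divisors.  By the Noetherian hypothesis finitely
    many of them are all: if g is in I + (g_1, ..., g_n), then the
    annihilator of g contains the intersection of those of the g_i, hence one
    of these.  So prime avoidance gives an element of m outside all. *)
Lemma nzdiv_exists I m :
  noetherian -> ideal I -> ideal m ->
  (forall g, (forall x, m x -> I (x * g)) -> I g) ->
  exists2 f, m f & nzdiv I f.
Proof.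
move=> nA hI hm socle.
pose ann g a := I (a * g).
have hann g : ideal (ann g).
  split; rewrite /ann; first by rewrite mul0r; apply: ideal0.
    by move=> a b ? ?; rewrite mulrDl; apply: idealD.
  by move=> c a ?; rewrite -mulrA; apply: idealM.
pose maxann g := ~ I g /\ forall h, ~ I h -> (forall a, ann g a -> ann h a) ->
   forall a, ann h a -> ann g a.
pose T := {g | maxann g}; pose p (t : T) := ann (sval t).
have above g : ~ I g -> exists t : T, forall a, ann g a -> p t a.
  move=> ng; pose U := {h | ~ I h /\ forall a, ann g a -> ann h a}.
  have g0 : ~ I g /\ forall a, ann g a -> ann g a by [].
  have [[h [nh gh]] hmax] :=
    @noetherian_max U (fun h => ann (sval h)) (exist _ g g0) nA (fun h => hann _).
  have hM : maxann h.
    split=> // h' nh' hh' a; have P' : ~ I h' /\ forall a, ann g a -> ann h' a.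
      by split=> // b /gh /hh'.
    exact: (hmax (exist _ h' P') hh').
  by exists (exist _ h hM).
have pr t a b : p t (a * b) -> p t a \/ p t b.
  case: t => [g [ng gmax]]; rewrite /p /= /ann => Iab.
  case: (classic (I (b * g))) => [|nb]; [by right|left].
  apply: (gmax (b * g)) => // [c|]; last by rewrite /ann mulrA.
  by move/(idealM hI b); rewrite mulrCA.
have pmax t t' : (forall a, p t a -> p t' a) -> forall a, p t' a -> p t a.
  by case: t t' => [g [ng gmax]] [g' [ng' g'max]]; exact: (gmax g' ng').
have hgen (l : seq T) : ideal (add_gens I [seq sval t | t <- l]).
  exact: add_gens_ideal.
have [l lmax] := noetherian_max [::] nA hgen.
have [f mf fl] : exists2 a, m a & forall t, List.In t l -> ~ p t a.
  apply: prime_avoidance => // [t|t]; first exact: hann.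
  apply: NNPP => no; apply: (proj1 (svalP t)); apply: socle => x mx.
  by apply: NNPP => nx; apply: no; exists x.
exists f => // g; rewrite mulrC => Ifg; apply: NNPP => ng.
have [t gt] := above g ng.
have : add_gens I [seq sval t | t <- l] (sval t).
  apply: (lmax (t :: l)) => [h|].
    apply: gen_ideal_min => [|h' [?|?]]; first exact: hgen.
      by apply: gen_ideal_sub; left.
    by apply: gen_ideal_sub; right; rewrite inE; apply/orP; right.
  by apply: gen_ideal_sub; right; rewrite mem_head.
move=> tl.
have [t' t'l t't] : exists2 t', List.In t' l & forall a, p t' a -> p t a.
  apply: NNPP => no.
  have [b nb bl] : exists2 b, ~ p t b & forall t', List.In t' l -> p t' b.
    elim: l no {lmax fl tl} => [|t' l IHl] no.
      exists 1 => //; rewrite /p /ann mul1r; by case: (t) => [? []].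
    have [|b nb bl] := IHl.
      by case=> t1 t1l h; apply: no; exists t1 => //; right.
    have [c ct' nct] : exists2 c, p t' c & ~ p t c.
      apply: NNPP => no'; apply: no; exists t'; first by left.
      by move=> c pc; apply: NNPP => npc; apply: no'; exists c.
    exists (b * c); first by case/pr.
    move=> t1 [<-|/bl ?]; first exact: (idealM (hann _)).
    exact: (ideal_mulr (hann _)).
  apply: nb; rewrite /p /ann.
  have hb : ideal (fun h => I (b * h)).
    split; first by rewrite mulr0; apply: ideal0.
      by move=> *; rewrite mulrDr; apply: idealD.
    by move=> c a ?; rewrite mulrCA; apply: idealM.
  apply: (gen_ideal_min hb) tl => h [?|]; first exact: idealM.
  elim: (l) bl => //= t1 l1 IHl bl; rewrite inE => /orP [/eqP ->|].
    by apply: (bl t1); left.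
  by apply: IHl => t2 t2l; apply: bl; right.
by apply: (fl t' t'l); apply: pmax t't _ _; apply: gt.
Qed.

End CommutativeAlgebra.

(** * Koszul homology and depth *)
Section Koszul.
Variables (A : comNzRingType) (N : nat) (x : 'I_N -> A).
Implicit Types (T : {set 'I_N}) (l m : 'I_N) (I J Q : A -> Prop).

(** The sign that brings e_l to its place among the e_i with i in T. *)
Definition ksign l T : A := (-1) ^+ #|[set i in T | (i < l)%N]|.

Lemma ksignU1 l m T : m \notin T -> ksign l (m |: T) = (-1) ^+ (m < l)%N * ksign l T.
Proof.
move=> mT; rewrite /ksign -exprD; congr (_ ^+ _).
have [ml|ml] := boolP (m < l)%N.
  have -> : [set i in m |: T | (i < l)%N] = m |: [set i in T | (i < l)%N].
    by apply/setP => i; rewrite !inE; case: eqP => // ->; rewrite ml.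
  by rewrite cardsU1 !inE (negPf mT).
congr #|pred_of_set _|; apply/setP => i; rewrite !inE.
by case: eqP => // ->; rewrite (negPf ml) (negPf mT).
Qed.

Lemma ksignD1 l m T : m \in T -> ksign l (T :\ m) = (-1) ^+ (m < l)%N * ksign l T.
Proof.
move=> mT; rewrite -{2}(setD1K mT) ksignU1 ?setD11 //.
by rewrite mulrA -exprD addnn -mul2n exprM sqrrN expr1n expr1n mul1r.
Qed.

Lemma ksign_sq l T : ksign l T * ksign l T = 1.
Proof. by rewrite -expr2 sqrr_sign. Qed.

Lemma ksign_anti l m : l != m ->
  (-1) ^+ (l < m)%N = - (-1) ^+ (m < l)%N :> A.
Proof.
by move=> lm; case: ltngtP lm => [_ _|_ _|/val_inj ->]; rewrite ?opprK ?eqxx.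
Qed.

Section Operators.
Variable V : lmodType A.
Local Notation K := {ffun {set 'I_N} -> V}.
Implicit Types (w v : K).

(** A Koszul chain is the function that sends T to its coefficient at e_T.
    The operators [contract l] and [wed l] are contraction with, and exterior
    multiplication by, the basis vector e_l; they satisfy the Clifford relations
    from which the identities for the differential follow. *)
Definition contract l w : K :=
  [ffun T : {set 'I_N} => if l \in T then 0 else ksign l T *: w (l |: T)].
Definition wed l w : K :=
  [ffun T : {set 'I_N} => if l \in T then ksign l T *: w (T :\ l) else 0].

Lemma contract_is_linear l : linear (contract l).
Proof.
move=> a u v; apply/ffunP => T; rewrite !ffunE; case: ifP => _.
  by rewrite scaler0 addr0.
by rewrite scalerDr !scalerA mulrC.
Qed.

Lemma wed_is_linear l : linear (wed l).
Proof.
move=> a u v; apply/ffunP => T; rewrite !ffunE; case: ifP => _.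
  by rewrite scalerDr !scalerA mulrC.
by rewrite scaler0 addr0.
Qed.

HB.instance Definition _ l := GRing.isLinear.Build A K K _ (contract l) (contract_is_linear l).
HB.instance Definition _ l := GRing.isLinear.Build A K K _ (wed l) (wed_is_linear l).

Lemma contract_contractC l m w : l != m -> contract l (contract m w) = - contract m (contract l w).
Proof.
move=> lm; apply/ffunP => T; rewrite !ffunE !inE [m == l]eq_sym (negPf lm) /=.
have [lT|lT] := boolP (l \in T); first by case: ifP => _; rewrite ?scaler0 oppr0.
have [mT|mT] := boolP (m \in T); first by rewrite scaler0 oppr0.
rewrite setUCA !scalerA !ksignU1 // (ksign_anti lm) -scaleNr; congr (_ *: _).
by ring.
Qed.

Lemma contract_contract l w : contract l (contract l w) = 0.
Proof.
by apply/ffunP => T; rewrite !ffunE setU11 scaler0; case: ifP.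
Qed.

Lemma contract_wedC l m w : l != m -> contract l (wed m w) = - wed m (contract l w).
Proof.
move=> lm; apply/ffunP => T; rewrite !ffunE !inE (negPf lm) [m == l]eq_sym (negPf lm) /=.
have [lT|lT] := boolP (l \in T); first by case: ifP => _; rewrite ?scaler0 oppr0.
have [mT|mT] := boolP (m \in T); last by rewrite scaler0 oppr0.
have -> : (l |: T) :\ m = l |: (T :\ m).
  apply/setP => i; rewrite !inE; case: (i =P m) => [->|] //=.
  by rewrite eq_sym (negPf lm).
rewrite !scalerA ksignU1 // ksignD1 // -scaleNr; congr (_ *: _).
by rewrite (ksign_anti lm); ring.
Qed.

Lemma contract_wed l w : contract l (wed l w) + wed l (contract l w) = w.
Proof.
apply/ffunP => T; rewrite !ffunE !inE eqxx /=.
have [lT|lT] := boolP (l \in T).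
  rewrite add0r setD1K // scalerA ksignD1 // ltnn mul1r.
  by rewrite ksign_sq scale1r.
rewrite addr0 setU1K // scalerA ksignU1 // ltnn mul1r.
by rewrite ksign_sq scale1r.
Qed.

(** The Koszul differential, and exterior multiplication by sum_l g_l e_l. *)
Definition bd w : K := \sum_l x l *: contract l w.
Definition ht (g : 'I_N -> A) w : K := \sum_l g l *: wed l w.

Lemma bd_is_linear : linear bd.
Proof.
move=> a u v; rewrite /bd scaler_sumr -big_split; apply: eq_bigr => l _ /=.
by rewrite linearP scalerDr !scalerA mulrC.
Qed.

HB.instance Definition _ := GRing.isLinear.Build A K K _ bd bd_is_linear.

Lemma bd_bd w : bd (bd w) = 0.
Proof.
pose F l m := (x l * x m) *: contract l (contract m w).
have -> : bd (bd w) = \sum_l \sum_m F l m.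
  apply: eq_bigr => l _; rewrite /bd linear_sum scaler_sumr.
  by apply: eq_bigr => m _; rewrite linearZ scalerA.
have -> : \sum_l \sum_m F l m =
    \sum_(l < N) \sum_(m < N | (l < m)%N) F l m
    + \sum_(l < N) \sum_(m < N | (m < l)%N) F l m.
  rewrite -big_split; apply: eq_bigr => l _ /=.
  rewrite (bigID (fun m : 'I_N => (l < m)%N)) /=; congr (_ + _).
  rewrite (bigD1 l) ?ltnn //= {1}/F contract_contract scaler0 add0r.
  apply: eq_bigl => m; rewrite -leqNgt.
  by rewrite [(m < l)%N]ltn_neqAle andbC.
rewrite (exchange_big_dep xpredT) //= -big_split /= big1 // => l _.
rewrite -big_split /= big1 // => m ml; rewrite /F contract_contractC; last first.
  by rewrite -val_eqE /= neq_ltn ml.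
by rewrite [x m * x l]mulrC scalerN addNr.
Qed.

Lemma bd_ht g w : bd (ht g w) + ht g (bd w) = (\sum_l g l * x l) *: w.
Proof.
have -> : bd (ht g w) = \sum_l \sum_m (g m * x l) *: contract l (wed m w).
  apply: eq_bigr => l _; rewrite /ht linear_sum scaler_sumr.
  by apply: eq_bigr => m _; rewrite linearZ scalerA mulrC.
have -> : ht g (bd w) = \sum_l \sum_m (g m * x l) *: wed m (contract l w).
  rewrite exchange_big; apply: eq_bigr => m _; rewrite /bd linear_sum scaler_sumr.
  by apply: eq_bigr => l _; rewrite linearZ scalerA.
rewrite -big_split scaler_suml; apply: eq_bigr => l _ /=.
rewrite -big_split (bigD1 l) //= big1 ?addr0 => [|m ml].
  by rewrite -scalerDr contract_wed.
by rewrite contract_wedC 1?eq_sym // scalerN addNr.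
Qed.

Lemma bdE w T :
  bd w T = \sum_l x l *: (if l \in T then 0 else ksign l T *: w (l |: T)).
Proof. by rewrite sum_ffunE; apply: eq_bigr => l _; rewrite !ffunE. Qed.

Lemma htE g w T :
  ht g w T = \sum_l g l *: (if l \in T then ksign l T *: w (T :\ l) else 0).
Proof. by rewrite sum_ffunE; apply: eq_bigr => l _; rewrite !ffunE. Qed.

Definition kdeg i w := forall T, #|T| != i -> w T = 0.

Lemma kdegB i w v : kdeg i w -> kdeg i v -> kdeg i (w - v).
Proof. by move=> wi vi T Ti; rewrite !ffunE wi // vi // subr0. Qed.

Lemma kdegZ i a w : kdeg i w -> kdeg i (a *: w).
Proof. by move=> wi T Ti; rewrite !ffunE wi // scaler0. Qed.

Lemma kdeg_bd i w : kdeg i.+1 w -> kdeg i (bd w).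
Proof.
move=> wi T Ti; rewrite sum_ffunE big1 // => l _; rewrite !ffunE.
case: ifP => lT; first by rewrite scaler0.
by rewrite wi ?scaler0 // cardsU1 lT.
Qed.

Lemma kdeg0_bd w : kdeg 0 w -> bd w = 0.
Proof.
move=> w0; apply/ffunP => T; rewrite sum_ffunE ffunE big1 // => l _; rewrite !ffunE.
case: ifP => lT; first by rewrite scaler0.
by rewrite w0 ?scaler0 // cardsU1 lT.
Qed.

Lemma kdeg_ht i g w : kdeg i w -> kdeg i.+1 (ht g w).
Proof.
move=> wi T Ti; rewrite sum_ffunE big1 // => l _; rewrite !ffunE.
case: ifP => lT; last by rewrite scaler0.
by rewrite wi ?scaler0 //; rewrite (cardsD1 l) lT in Ti.
Qed.

Definition kpart i w : K := [ffun T : {set 'I_N} => if #|T| == i then w T else 0].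

Lemma kpart_deg i w : kdeg i (kpart i w).
Proof. by move=> T /negPf Ti; rewrite ffunE Ti. Qed.

Lemma kpart_id i w : kdeg i w -> kpart i w = w.
Proof.
by move=> wi; apply/ffunP => T; rewrite ffunE; case: eqP => // /eqP /wi.
Qed.

Lemma kdeg_big i w : (N < i)%N -> kdeg i w -> w = 0.
Proof.
move=> Ni wi; apply/ffunP => T; rewrite ffunE wi //; apply: contraTneq Ni => <-.
by rewrite -leqNgt -[N in (_ <= N)%N]card_ord max_card.
Qed.

End Operators.

Definition kmap (V W : lmodType A) (f : V -> W) (w : {ffun {set 'I_N} -> V}) :
  {ffun {set 'I_N} -> W} := [ffun T => f (w T)].

Lemma kmapE (V W : lmodType A) (f : V -> W) w T : kmap f w T = f (w T).
Proof. exact: ffunE. Qed.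

Lemma bd_kmap (V W : lmodType A) (f : {linear V -> W}) w :
  bd (kmap f w) = kmap f (bd w).
Proof.
apply/ffunP => T; rewrite [RHS]ffunE !sum_ffunE linear_sum; apply: eq_bigr => l _.
rewrite !ffunE [RHS]linearZ /=; congr (_ *: _); case: ifP => _; first by rewrite linear0.
by rewrite [RHS]linearZ.
Qed.

Local Notation K := {ffun {set 'I_N} -> A^o}.
Implicit Types (w v : K).

Definition kin I w := forall T, I (w T).

Definition kone : K := [ffun T : {set 'I_N} => if T == set0 then 1 else 0].

Lemma kone_deg : kdeg 0 kone.
Proof. by move=> T; rewrite cards_eq0 ffunE => /negPf ->. Qed.

Lemma bd_ht_kone g : bd (ht g kone) = (\sum_l g l * x l) *: kone.
Proof.
rewrite -bd_ht (kdeg0_bd kone_deg) [ht g 0](_ : _ = 0) ?addr0 //.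
by rewrite /ht big1 // => l _; rewrite linear0 scaler0.
Qed.

Lemma ideal_sumo I (p : pred 'I_N) (F : 'I_N -> A^o) :
  ideal I -> (forall i, p i -> I (F i)) -> I (\sum_(i | p i) F i).
Proof. exact: (@ideal_sum A I 'I_N (index_enum _) p F). Qed.

Lemma idealZ I c (a : A^o) : ideal I -> I a -> I (c *: a).
Proof. by move=> hI; exact: (idealM hI). Qed.

Lemma kin_bd I w : ideal I -> kin I w -> kin I (bd w).
Proof.
move=> hI Iw T; rewrite sum_ffunE; apply: (ideal_sumo hI) => l _; rewrite !ffunE.
apply: (idealZ _ hI); case: ifP => _; first exact: (ideal0 hI).
by apply: (idealZ _ hI).
Qed.

Lemma kin_ht I g w : ideal I -> kin I w -> kin I (ht g w).
Proof.
move=> hI Iw T; rewrite sum_ffunE; apply: (ideal_sumo hI) => l _; rewrite !ffunE.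
apply: (idealZ _ hI); case: ifP => _; last exact: (ideal0 hI).
by apply: (idealZ _ hI).
Qed.

(** The i-th Koszul homology of [x] on A / I vanishes; chains on A / I are
    represented by chains on A. *)
Definition acyclic I i := forall w, kdeg i w -> kin I (bd w) ->
  exists2 v, kdeg i.+1 v & kin I (w - bd v).

Lemma acyclic_ext I J i : (forall g, I g <-> J g) -> acyclic I i -> acyclic J i.
Proof.
move=> IJ aI w wi Jw; have [|v vi Iv] := aI w wi; first by move=> T; apply/IJ/Jw.
by exists v => // T; apply/IJ/Iv.
Qed.

Definition xideal f := exists g : 'I_N -> A, f = \sum_l g l * x l.

Lemma xideal_ideal : ideal xideal.
Proof.
split.
- by exists (fun _ => 0); rewrite big1 // => l _; rewrite mul0r.
- move=> a b [g ->] [h ->]; exists (fun l => g l + h l).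
  by rewrite -big_split; apply: eq_bigr => l _; rewrite mulrDl.
- move=> c a [g ->]; exists (fun l => c * g l).
  by rewrite mulr_sumr; apply: eq_bigr => l _; rewrite mulrA.
Qed.

Lemma kin_adjoin I f i w : ideal I -> kdeg i w -> kin (adjoin I f) w ->
  exists2 u, kdeg i u & kin I (w - f *: u).
Proof.
move=> hI wi /fin_all_exists [a wa]; exists (kpart i ([ffun T : {set 'I_N} => (a T : A^o)] : K)).
  exact: kpart_deg.
move=> T; rewrite !ffunE; case: ifP => [_|/negbT Ti].
  by move: (wa T); rewrite mulrC.
by rewrite wi // scaler0 subr0; apply: (ideal0 hI).
Qed.

(** Since f = sum g_l x_l, exterior multiplication by sum g_l e_l is a homotopy
    from f to 0, so f kills all Koszul homology.  Hence if f is a nonzero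
    divisor on A / I, then a class in degree i on A / I comes from degree i + 1
    on A / (I + f); iterating along [s] one leaves the range of degrees. *)
Lemma acyclic_wreg s : forall I i, ideal I -> {in s, forall f, xideal f} ->
  wreg s I -> (N < i + size s)%N -> acyclic I i.
Proof.
elim: s => [|f s IHs] I i hI sm /=.
  rewrite addn0 => _ Ni w wi Iw; exists 0; first by move=> T _; rewrite ffunE.
  by rewrite (kdeg_big Ni wi) linear0 subr0 => T; rewrite ffunE; apply: (ideal0 hI).
move=> [fI sI] Ni w wi Iw.
have [g fE] := sm f (mem_head _ _).
have hJ := adjoin_ideal f hI.
have sm' : {in s, forall h, xideal h}.
  by move=> h hs; apply: sm; rewrite inE hs orbT.
have Ni' : (N < i.+1 + size s)%N by rewrite addSnnS.
have bh := bd_ht g w; rewrite -fE in bh.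
have cyc : kin (adjoin I f) (bd (ht g w)).
  move=> T; have -> : bd (ht g w) = f *: w - ht g (bd w) by rewrite -bh addrK.
  rewrite !ffunE; apply: (idealB hJ); last by apply: adjoin_sub; apply: kin_ht.
  by rewrite /GRing.scale /= mulrC; apply: adjoin_gen.
have [v vi hv] := IHs _ i.+1 hJ sm' sI Ni' _ (kdeg_ht g wi) cyc.
have [u ui hu] := kin_adjoin hI (kdegB (kdeg_ht g wi) (kdeg_bd vi)) hv.
exists u => // T; apply: fI; rewrite mulrC.
have := kin_bd hI hu T; rewrite linearB /= linearB /=. rewrite bd_bd subr0 linearZ /=.
have -> : bd (ht g w) = f *: w - ht g (bd w) by rewrite -bh addrK.
move=> h; rewrite -[_ * _]/(f *: (w - bd u) T).
have -> : f *: (w - bd u) T =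
    (f *: w - ht g (bd w) - f *: bd u) T + ht g (bd w) T.
  by rewrite !ffunE scalerBr /=; ring.
by apply: (idealD hI) => //; apply: kin_ht.
Qed.

(** This is H_(i+1) (A / I) -> H_(i+1) (A / (I + F)) -> H_i (A / Q), a part of
    the long exact sequence of 0 -> A / Q -> A / I -> A / (I + F) -> 0 whose
    first map is multiplication by F. *)
Lemma acyclic_adjoin I Q F i : ideal I -> (forall g, Q g <-> I (g * F)) ->
  acyclic I i.+1 -> acyclic Q i -> acyclic (adjoin I F) i.+1.
Proof.
move=> hI QI aI aQ w wi Iw.
have [v vi hv] := kin_adjoin hI (kdeg_bd wi) Iw.
have Qbv : kin Q (bd v).
  move=> T; apply/QI; have := kin_bd hI hv T.
  rewrite linearB /= bd_bd sub0r linearZ !ffunE /= => /(idealN hI).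
  by rewrite opprK /GRing.scale /= mulrC.
have [u ui hu] := aQ v vi Qbv.
have Iwu : kin I (bd (w - F *: u)).
  move=> T; rewrite linearB linearZ /=.
  have -> : bd w - F *: bd u = (bd w - F *: v) + F *: (v - bd u).
    by rewrite scalerBr addrA subrK.
  rewrite ffunE; apply: (idealD hI); first exact: hv.
  have /QI := hu T; rewrite [(F *: (_ : K)) T]ffunE /GRing.scale /= mulrC; exact.
have [t ti ht] := aI _ (kdegB wi (kdegZ F ui)) Iwu.
exists t => // T; exists (u T); have := ht T; rewrite !ffunE /GRing.scale /=.
by rewrite [F * _]mulrC addrAC.
Qed.

Lemma acyclic_adjoin0 I F : ideal I -> acyclic I 0 -> acyclic (adjoin I F) 0.
Proof.
move=> hI aI w w0 _.
have [|v vi hv] := aI w w0.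
  by rewrite kdeg0_bd // => T; rewrite ffunE; apply: (ideal0 hI).
by exists v => // T; apply: adjoin_sub.
Qed.

(** The top Koszul homology of A / I is its socle (I : x) / I. *)
Lemma acyclic_socle I : ideal I -> acyclic I N ->
  forall g, (forall y, xideal y -> I (y * g)) -> I g.
Proof.
move=> hI aI g gI; pose w : K := [ffun T => if T == [set: 'I_N] then g else 0].
have wN : kdeg N w.
  move=> T; rewrite ffunE; case: (T =P _) => // ->.
  by rewrite cardsT card_ord eqxx.
have xl l : xideal (x l).
  exists (fun m => (m == l)%:R); rewrite (bigD1 l) //= eqxx mul1r big1 ?addr0 //.
  by move=> m /negPf ->; rewrite mul0r.
have [|v vN /(_ [set: 'I_N])] := aI w wN.
  move=> T; rewrite sum_ffunE; apply: (ideal_sumo hI) => l _; rewrite !ffunE.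
  case: ifP => _; first by rewrite scaler0; apply: (ideal0 hI).
  rewrite scalerA mulrC -scalerA; apply: (idealZ _ hI).
  case: ifP => _; last by rewrite scaler0; apply: (ideal0 hI).
  by apply: gI.
by rewrite (kdeg_big _ vN) // linear0 !ffunE eqxx subr0.
Qed.

(** Depth sensitivity of the Koszul complex: a vanishing socle yields a nonzero
    divisor f in the ideal of [x], and passing from A / I to A / (I + f)
    costs one degree of vanishing. *)
Lemma acyclic_regular e : noetherian A -> forall I, ideal I ->
  (forall i, (N < i + e)%N -> acyclic I i) ->
  exists2 s, size s = e & {in s, forall f, xideal f} /\ wreg s I.
Proof.
move=> nA; elim: e => [|e IHe] I hI aI; first by exists [::].
have [|f mf fI] := nzdiv_exists nA hI xideal_ideal.
  by apply: acyclic_socle => //; apply: aI; rewrite addnS ltnS leq_addr.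
have [|s se [sm sI]] := IHe _ (adjoin_ideal f hI).
  case=> [|i] Ni.
    by apply: acyclic_adjoin0 => //; apply: aI; rewrite addnS ltnW.
  apply: (@acyclic_adjoin I I) => //.
  - by move=> g; split=> [Ig|]; [exact: ideal_mulr|exact: fI].
  - by apply: aI; rewrite addnS ltnW.
  - by apply: aI; rewrite addnS -addSn.
exists (f :: s); first by rewrite /= se.
by split=> // h; rewrite inE => /orP [/eqP ->|/sm].
Qed.

End Koszul.

(** * Polynomial rings: Noetherianity and regularity of the variables *)
Lemma tail_argmin (b : nat -> nat) j :
  exists i, (j <= i)%N /\ forall i', (j <= i')%N -> (b i <= b i')%N.
Proof.
suff h v : forall j', (j <= j')%N -> (b j' <= v)%N ->
    exists i, (j <= i)%N /\ forall i', (j <= i')%N -> (b i <= b i')%N.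
  exact: (h (b j) j).
elim: v => [|v IHv] j' jj' bv.
  by exists j'; split=> // i' _; rewrite (leq_trans bv).
have [[i' [ji' lt]]|no] := classic (exists i', (j <= i')%N /\ (b i' < b j')%N).
  by apply: (IHv i') => //; rewrite -ltnS (leq_trans lt).
exists j'; split=> // i' ji'; rewrite leqNgt; apply/negP => lt.
by apply: no; exists i'.
Qed.

(** Dickson: passing to a subsequence, each coordinate in turn becomes
    nondecreasing, by taking successive minima of its tails. *)
Lemma dickson n (a : nat -> 'X_{1..n}) :
  exists i j, (i < j)%N /\ (a i <= a j)%MM.
Proof.
suff [psi [psi_lt psi_le]] : exists psi : nat -> nat,
    (forall i, psi i < psi i.+1)%N /\
    forall c : 'I_n, c \in enum 'I_n -> forall i j, (i <= j)%N ->
      (a (psi i) c <= a (psi j) c)%N.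
  exists (psi 0%N), (psi 1%N); split=> //; apply/mnm_lepP => c.
  by apply: psi_le; rewrite ?mem_enum.
elim: (enum _) => [|c cs [psi [psi_lt psi_le]]]; first by exists id.
pose b i := a (psi i) c.
have am j : {i | (j <= i)%N /\ forall i', (j <= i')%N -> (b i <= b i')%N}.
  by apply: constructive_indefinite_description; apply: tail_argmin.
pose f := fix f i := if i is i'.+1 then sval (am (f i').+1) else sval (am 0%N).
have f_lt i : (f i < f i.+1)%N by case: (svalP (am (f i).+1)).
have mono (h : nat -> nat) : (forall i, h i < h i.+1)%N ->
    forall i j, (i <= j)%N -> (h i <= h j)%N.
  move=> hlt i j; elim: j => [|j IHj]; first by rewrite leqn0 => /eqP ->.
  rewrite leq_eqVlt => /orP [/eqP -> //|]; rewrite ltnS => /IHj /leq_trans; apply.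
  exact: ltnW.
have f_le := mono f f_lt.
exists (psi \o f); split=> [i /=|c'].
  by apply: leq_trans (psi_lt _) _; apply: mono.
rewrite inE => /orP [/eqP ->|c's] i j ij /=; last first.
  by apply: psi_le => //; apply: f_le.
have fmin i' : forall j', (f i' <= j')%N -> (b (f i') <= b j')%N.
  case: i' => [|i'] j' le /=; first by case: (svalP (am 0%N)) => _; apply.
  case: (svalP (am (f i').+1)) => le' h; apply: h; exact: leq_trans le.
exact: fmin (f_le _ _ ij).
Qed.

Section PolynomialRing.
Variables (k : fieldType) (n : nat).
Local Notation R := {mpoly k[n]}.

Lemma mlead_lt (f g : R) : f - g != 0 -> (mlead g <= mlead f)%O ->
  g@_(mlead f) = f@_(mlead f) -> (mlead (f - g) < mlead f)%O.
Proof.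
move=> nz le_gf eq_c; rewrite lt_neqAle; apply/andP; split.
  apply: contraNneq nz => eqm; rewrite -mleadc_eq0 eqm mcoeffB eq_c subrr //.
by apply: (le_trans (mleadB_le _ _)); rewrite leUx le_gf lexx.
Qed.

(** Choosing in an ideal J that is not finitely generated, again and again,
    an element of least leading monomial outside the ideal of the previous
    ones, one gets leading monomials none of which divides a later one. *)
Lemma noetherian_mpoly : noetherian R.
Proof.
move=> J hJ; apply: NNPP => nofg.
pose gen (s : seq R) := gen_ideal (fun g => g \in s).
have hgen s : ideal (gen s) by exact: gen_ideal_ideal.
pose U := {s : seq R | {in s, forall f, J f}}.
have next (u : U) : {f | J f /\ ~ gen (sval u) f /\
    forall g, J g -> ~ gen (sval u) g -> (mlead f <= mlead g)%O}.
  apply: constructive_indefinite_description.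
  have [f Jf nf] : exists2 f, J f & ~ gen (sval u) f.
    apply: NNPP => no; apply: nofg; exists (sval u); first exact: (svalP u).
    by move=> f Jf; apply: NNPP => nf; apply: no; exists f.
  elim/(well_founded_ind (@ltom_wf n)): {f}(mlead f) {-2}f (erefl (mlead f)) Jf nf
    => m IHm f fm Jf nf.
  have [[g [Jg [ng lt]]]|no] :=
    classic (exists g, J g /\ ~ gen (sval u) g /\ (mlead g < mlead f)%O).
    by apply: (IHm (mlead g)) => //; rewrite -fm.
  exists f; split=> //; split=> // g Jg ng.
  by rewrite leNgt; apply/negP => lt; apply: no; exists g.
pose f u := sval (next u).
have consP (u : U) : {in f u :: sval u, forall g, J g}.
  move=> g; rewrite inE => /orP [/eqP ->|]; first by case: (svalP (next u)).
  exact: (svalP u).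
have nilP : {in [::], forall g : R, J g} by [].
pose u := nat_rect (fun _ => U) (exist _ [::] nilP)
  (fun _ u => exist _ (f u :: sval u) (consP u)).
have fu i j : (i < j)%N -> f (u i) \in sval (u j).
  elim: j => // j IHj; rewrite ltnS leq_eqVlt => /orP [/eqP -> /=|/IHj].
    by rewrite mem_head.
  by rewrite /= inE => ->; rewrite orbT.
have [i [j [ij le]]] := dickson (fun i => mlead (f (u i))).
have [Ji _] := svalP (next (u i)).
have [Jj [nj jmin]] := svalP (next (u j)).
rewrite -/(f (u i)) in Ji; rewrite -/(f (u j)) in Jj nj jmin.
have gi : gen (sval (u j)) (f (u i)) by apply: gen_ideal_sub; apply: fu.
have nzi : f (u i) != 0.
  apply/eqP => fi0; case: (svalP (next (u i))) => _ [+ _]; apply.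
  by rewrite -/(f _) fi0; apply: ideal0.
have nzj : f (u j) != 0 by apply/eqP => f0; apply: nj; rewrite f0; apply: ideal0.
set fi := f (u i) in le Ji gi nzi; set fj := f (u j) in le Jj nj jmin nzj.
have ci : fi@_(mlead fi) != 0 by rewrite mleadc_eq0.
pose c := fj@_(mlead fj) / fi@_(mlead fi).
pose h := (c *: 'X_[mlead fj - mlead fi]) * fi.
have ng : ~ gen (sval (u j)) (fj - h).
  move=> gh; apply: nj; apply: (ideal_sub_trans (hgen _) gh).
  by apply: (idealM (hgen _)).
have hlead : mlead h = mlead fj.
  have cn0 : c != 0 by rewrite mulf_neq0 ?invr_eq0 // mleadc_eq0.
  rewrite mleadM ?scaler_eq0 ?negb_or ?cn0 //=; last first.
    by rewrite -msupp_eq0 msuppX.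
  by rewrite mleadZ // mleadXm submK.
have hc : h@_(mlead fj) = fj@_(mlead fj).
  rewrite /h -scalerAl mcoeffZ mulrC [X in X * _](_ : _ = fi@_(mlead fi)).
    by rewrite /c mulrCA divff ?mulr1.
  by rewrite mulrC -{1}(submK le) mcoeffMX.
have := jmin (fj - h) _ ng; rewrite leNgt mlead_lt ?hlead //.
  by move/(_ _)/negP; apply => //; apply: (idealB hJ) => //; apply: (idealM hJ).
by apply/eqP => h0; apply: ng; rewrite h0; apply: ideal0.
Qed.

(** The ideal generated by the variables with index in S, which is a monomial
    ideal and thus determined by supports. *)
Definition var_ideal (S : {pred 'I_n}) (f : R) : Prop :=
  {in msupp f, forall m : 'X_{1..n}, exists2 i, i \in S & m i != 0%N}.

Lemma var_ideal_ideal S : ideal (var_ideal S).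
Proof.
split.
- by move=> m; rewrite msupp0.
- move=> a b Sa Sb m /msuppD_le; rewrite mem_cat => /orP [/Sa|/Sb] //.
- move=> c a Sa m /msuppM_le /allpairsP [[m1 m2] /= [_ /Sa [i iS mi] ->]].
  by exists i; rewrite // mnmDE addn_eq0 negb_and mi orbT.
Qed.

Lemma var_ideal_X (S : {pred 'I_n}) (m : 'X_{1..n}) i : i \in S -> m i != 0%N -> var_ideal S 'X_[m].
Proof. by move=> iS mi m' /mem_msuppXP <-; exists i. Qed.

Lemma var_ideal0 f : var_ideal pred0 f <-> f = 0.
Proof.
split=> [h|->]; last by move=> m; rewrite msupp0.
apply/eqP; rewrite -msupp_eq0; case E: (msupp f) h => [//|m s] h.
by have [|i] := h m; rewrite ?E ?mem_head.
Qed.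

Lemma mpolyX_factor (m : 'X_{1..n}) i : m i != 0%N ->
  'X_[m] = 'X_[(m - U_(i))%MM] * 'X_i :> R.
Proof.
move=> mi; rewrite -mpolyXD submK //; apply/mnm_lepP => j.
by rewrite mnm1E; case: eqP => [<-|]; rewrite ?lt0n.
Qed.

Lemma var_ideal_adjoin (S : {pred 'I_n}) i f :
  adjoin (var_ideal S) 'X_i f <-> var_ideal (predU1 i S) f.
Proof.
have hS := var_ideal_ideal S; have hS' := var_ideal_ideal (predU1 i S); split.
  case=> a Sa; apply: (ideal_sub_trans hS' (b := a * 'X_i)).
    by move=> m /Sa [j jS mj]; exists j => //; rewrite inE /=; apply/orP; right.
  apply: (idealM hS'); apply: (@var_ideal_X _ _ i); first by rewrite inE /= eqxx.
  by rewrite mnm1E eqxx.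
move=> Sf; rewrite (mpolyE f) big_seq; apply: ideal_sum; first exact: adjoin_ideal.
move=> m mf; rewrite -mul_mpolyC; apply: (idealM (adjoin_ideal _ hS)).
have [mi|mi] := boolP (m i != 0%N).
  by rewrite (mpolyX_factor mi); apply: adjoin_gen.
have [j] := Sf m mf; rewrite inE /= => /orP [/eqP ->|jS] mj.
  by rewrite mj in mi.
by apply: adjoin_sub; apply: var_ideal_X jS mj.
Qed.

Lemma var_nzdiv (S : {pred 'I_n}) i : i \notin S -> nzdiv (var_ideal S) 'X_i.
Proof.
move=> iS g Sg m mg.
have [|j jS mj] := Sg (U_(i) + m)%MM; first by rewrite mcoeff_msupp mcoeffMX -mcoeff_msupp.
exists j => //; move: mj; rewrite mnmDE mnm1E.
by case: (i =P j) => // ij; rewrite -ij (negPf iS) in jS.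
Qed.

Lemma var_wreg (s : seq 'I_n) (S : {pred 'I_n}) :
  uniq s -> {in s, forall i, i \notin S} ->
  wreg [seq 'X_i : R | i <- s] (var_ideal S).
Proof.
elim: s S => //= i s IHs S /andP [is_ us] sS; split.
  by apply: var_nzdiv; apply: sS; rewrite mem_head.
apply: (@wreg_ext _ _ (var_ideal (predU1 i S))); first by move=> g; rewrite var_ideal_adjoin.
apply: IHs => // j js; rewrite inE /= negb_or; apply/andP; split.
  by apply: contraNneq is_ => <-.
by apply: sS; rewrite inE js orbT.
Qed.

Lemma wreg_vars : wreg [seq 'X_i : R | i <- enum 'I_n] (fun f => f = 0).
Proof.
apply: (@wreg_ext _ _ (var_ideal pred0)) => [g|]; first exact: var_ideal0.
by apply: var_wreg; rewrite ?enum_uniq.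
Qed.

Lemma zero_ideal : ideal (fun f : R => f = 0).
Proof. by split=> // [a b -> ->|c a ->]; rewrite ?addr0 ?mulr0. Qed.

Lemma xideal_vars (f : R) : xideal (fun l => 'X_l) f <-> f@_0%MM = 0.
Proof.
split.
  case=> g ->; rewrite raddf_sum /= big1 // => l _.
  by rewrite rmorphM /= mcoeffX mnm1_eq0 mulr0.
move=> f0; rewrite (mpolyE f) big_seq; apply: ideal_sum.
  exact: xideal_ideal.
move=> m mf; rewrite -mul_mpolyC; apply: (idealM (xideal_ideal _)).
have [i mi] : exists i, m i != 0%N.
  apply/existsP; rewrite -negb_forall; apply/negP => /forallP m0.
  move: mf; rewrite (_ : m = 0%MM) ?mcoeff_msupp ?f0 ?eqxx //.
  by apply/mnmP => i; rewrite mnm0E; apply/eqP; apply: m0.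
rewrite (mpolyX_factor mi); apply: (idealM (xideal_ideal _)).
exists (fun l => (l == i)%:R); rewrite (bigD1 i) //= eqxx mul1r big1 ?addr0 //.
by move=> l /negPf ->; rewrite mul0r.
Qed.

(** The variables are a regular sequence on the ring itself, so the vanishing
    theorem for Koszul homology contains the exactness of the Koszul complex. *)
Lemma acyclic_vars i : (0 < i)%N ->
  acyclic (fun l => 'X_l : R) (fun f => f = 0) i.
Proof.
move=> i0; apply: (acyclic_wreg zero_ideal _ wreg_vars).
  move=> _ /mapP [l _ ->]; apply/xideal_vars.
  by rewrite mcoeffX mnm1_eq0.
by rewrite size_map size_enum_ord -{1}[n]add0n ltn_add2r.
Qed.

End PolynomialRing.

Lemma wreg_preim (A B : comNzRingType) (phi : {rmorphism A -> B}) (psi : B -> A)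
    (J : B -> Prop) (s : seq A) :
  cancel psi phi -> wreg [seq phi f | f <- s] J -> wreg s (fun f => J (phi f)).
Proof.
move=> psiK; elim: s J => //= f s IHs J [fJ sJ]; split.
  by move=> g; rewrite rmorphM => /fJ.
apply: (@wreg_ext _ _ (fun g => adjoin J (phi f) (phi g))); last exact: IHs.
move=> g; split=> -[a].
  by move=> h; exists (psi a); rewrite rmorphB rmorphM psiK.
by rewrite rmorphB rmorphM; exists (phi a).
Qed.

(** * Parts of polynomials and rows of Koszul chains *)
Section MonomialParts.
Variables (k : fieldType) (n : nat).
Local Notation R := {mpoly k[n]}.

Definition mpart (p : pred 'X_{1..n}) (f : R) : R :=
  \sum_(m <- msupp f | p m) f@_m *: 'X_[m].

Lemma mcoeff_mpart p f m : (mpart p f)@_m = if p m then f@_m else 0.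
Proof.
rewrite /mpart raddf_sum /=.
have [mf|mf] := boolP (m \in msupp f); last first.
  rewrite big_seq_cond big1 ?(memN_msupp_eq0 mf) ?if_same // => m' /andP [m'f _].
  rewrite mcoeffZ mcoeffX; case: eqP => [m'm|]; last by rewrite mulr0.
  by rewrite -m'm m'f in mf.
rewrite big_mkcond (bigD1_seq m) ?msupp_uniq //= big1 ?addr0 => [|m' m'm].
  by case: (p m); rewrite // mcoeffZ mcoeffX eqxx mulr1.
by case: (p m'); rewrite // mcoeffZ mcoeffX (negPf m'm) mulr0.
Qed.

Lemma mpart_supp p f m : m \in msupp (mpart p f) -> p m.
Proof. by rewrite mcoeff_msupp mcoeff_mpart; case: (p m); rewrite ?eqxx. Qed.

Lemma mpart_id (p : pred 'X_{1..n}) f :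
  {in msupp f, forall m : 'X_{1..n}, p m} -> mpart p f = f.
Proof.
move=> pf; apply/mpolyP => m; rewrite mcoeff_mpart.
have [/pf -> //|mf] := boolP (m \in msupp f).
by rewrite memN_msupp_eq0 // if_same.
Qed.

Lemma mpart_is_linear p : linear (mpart p).
Proof.
move=> a f g; apply/mpolyP => m.
rewrite mcoeff_mpart !linearP /= !mcoeff_mpart.
by case: (p m); rewrite // mulr0 addr0.
Qed.

HB.instance Definition _ p := GRing.isLinear.Build k R R _ (mpart p) (mpart_is_linear p).

Lemma mpart_sum p (I : Type) (s : seq I) (P : pred I) (F : I -> R) :
  mpart p (\sum_(i <- s | P i) F i) = \sum_(i <- s | P i) mpart p (F i).
Proof. exact: linear_sum. Qed.

Lemma mpartX (p : pred 'X_{1..n}) m : mpart p 'X_[m] = (p m)%:R *: 'X_[m].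
Proof.
apply/mpolyP => m'; rewrite mcoeff_mpart mcoeffZ mcoeffX.
by case: eqP => [->|_]; case: ifP; rewrite ?mul1r ?mul0r ?mulr0.
Qed.

Lemma mpartM (p q : pred 'X_{1..n}) f g :
  {in msupp g, forall m : 'X_{1..n}, forall m' : 'X_{1..n}, p (m' + m)%MM = q m'} ->
  mpart p (f * g) = mpart q f * g.
Proof.
move=> pq; rewrite (mpolyE g) !mulr_sumr linear_sum /= big_seq [RHS]big_seq.
apply: eq_bigr => m /pq {}pq.
rewrite -!scalerAr linearZ /=; congr (_ *: _).
rewrite (mpolyE f) mulr_suml [LHS]linear_sum [mpart q _]linear_sum mulr_suml.
apply: eq_bigr => m' _ /=.
by rewrite -scalerAl !linearZ /= -mpolyXD !mpartX pq -!scalerAl mpolyXD.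
Qed.

End MonomialParts.

Section Rows.
Variables (R : comNzRingType) (N : nat) (x : 'I_N -> R).

Definition coor q (j : 'I_q) (v : 'rV[R]_q) : R^o := v 0 j.

Lemma coor_is_linear q (j : 'I_q) : linear (coor j).
Proof. by move=> a u v; rewrite /coor !mxE. Qed.

HB.instance Definition _ q (j : 'I_q) :=
  GRing.isLinear.Build R 'rV[R]_q R^o _ (coor j) (coor_is_linear j).

Lemma bd_row q i (w : {ffun {set 'I_N} -> 'rV[R]_q}) :
  (forall j, exists2 v, kdeg i v & kmap (coor j) w = bd x v) ->
  exists2 v, kdeg i v & w = bd x v.
Proof.
move=> /fin_all_exists2 [v vi wv].
pose V : {ffun {set 'I_N} -> 'rV[R]_q} := [ffun T : {set 'I_N} => \row_j (v j T : R)].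
have vV j : kmap (coor j) V = v j by apply/ffunP => T; rewrite !ffunE /coor mxE.
exists V; first by move=> T Ti; apply/rowP => j; rewrite ffunE !mxE; exact: vi.
apply/ffunP => T; apply/rowP => j.
have : kmap (coor j) w T = kmap (coor j) (bd x V) T by rewrite wv -bd_kmap vV.
by rewrite !kmapE.
Qed.

Lemma bd_xideal (w : {ffun {set 'I_N} -> R^o}) :
  kdeg 0 w -> xideal x (w set0) -> exists2 v, kdeg 1 v & w = bd x v.
Proof.
move=> w0 [g wg]; exists (ht g (kone R N)); first exact/kdeg_ht/kone_deg.
rewrite bd_ht_kone; apply/ffunP => T; rewrite !ffunE -wg.
case: (T =P set0) => [->|/eqP nT]; first by rewrite /GRing.scale /= mulr1.
by rewrite scaler0 w0 // cards_eq0.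
Qed.

End Rows.

(** * The Koszul complex of a graded resolution *)
Section GradedResolution.
Variables (R : comNzRingType) (N r : nat) (x : 'I_N -> R).
Variable dx : 'I_N -> 'X_{1..r}.
(** The grading enters only through [hp beta sigma f], which stands for the
    component of f in degree beta when f is seen in the shifted module
    R(- sigma), that is, for the part of f of degree beta - sigma. *)
Variable hp : 'X_{1..r} -> 'X_{1..r} -> R -> R.
Implicit Types (T : {set 'I_N}) (beta sigma : 'X_{1..r}).
Hypothesis hpB : forall beta sigma, {morph hp beta sigma : f g / f - g}.
Hypothesis hpK : forall beta sigma f, hp beta sigma (hp beta sigma f) = hp beta sigma f.
Hypothesis hp_x : forall beta sigma l f,
  hp beta sigma (x l * f) = x l * hp beta (dx l + sigma)%MM f.
Hypothesis hp_neq : forall beta sigma f, sigma != beta -> xideal x (hp beta sigma f).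
Hypothesis x_acyclic : forall i, (0 < i)%N -> acyclic x (fun f => f = 0) i.

Lemma hp0 beta sigma : hp beta sigma 0 = 0.
Proof. by rewrite -{1}(subrr 0) hpB subrr. Qed.

Lemma hpN beta sigma f : hp beta sigma (- f) = - hp beta sigma f.
Proof. by rewrite -sub0r hpB hp0 sub0r. Qed.

Lemma hpD beta sigma f g : hp beta sigma (f + g) = hp beta sigma f + hp beta sigma g.
Proof. by rewrite -{1}(opprK g) hpB hpN opprK. Qed.

Lemma hp_sum beta sigma (I : Type) (s : seq I) (P : pred I) (F : I -> R) :
  hp beta sigma (\sum_(i <- s | P i) F i) = \sum_(i <- s | P i) hp beta sigma (F i).
Proof. exact: (big_morph _ (hpD beta sigma) (hp0 beta sigma)). Qed.

(** The multidegree of the basis element e_T of the Koszul complex. *)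
Definition wt T : 'X_{1..r} := (\sum_(l in T) dx l)%MM.

Lemma wtU1 l T : l \notin T -> wt (l |: T) = (dx l + wt T)%MM.
Proof. by move=> lT; rewrite /wt big_setU1. Qed.

Lemma wt0 : wt set0 = 0%MM.
Proof. by rewrite /wt big_set0. Qed.

Section Chains.
Variables (q : nat) (sh : 'I_q -> 'X_{1..r}) (beta : 'X_{1..r}).
Local Notation K := {ffun {set 'I_N} -> 'rV[R]_q}.

Definition chain_part (u : K) : K :=
  [ffun T : {set 'I_N} => \row_j hp beta (wt T + sh j)%MM (u T 0 j)].

Lemma chain_partK u : chain_part (chain_part u) = chain_part u.
Proof. by apply/ffunP => T; apply/rowP => j; rewrite !ffunE !mxE hpK. Qed.

Lemma chain_part_kdeg i u : kdeg i u -> kdeg i (chain_part u).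
Proof. by move=> ui T Ti; apply/rowP => j; rewrite ffunE ui // !mxE hp0. Qed.

Lemma chain_part_bd u : chain_part (bd x u) = bd x (chain_part u).
Proof.
apply/ffunP => T; apply/rowP => j; rewrite ffunE mxE.
rewrite !bdE !summxE hp_sum; apply: eq_bigr => l _.
case: ifP => [_|/negbT lT]; first by rewrite scaler0 mxE hp0.
rewrite ffunE !mxE hp_x /ksign -signr_odd !mulr_sign wtU1 // addmA.
by case: (odd _); rewrite ?hpN.
Qed.

End Chains.

Lemma chain_part_kmap q q' (sh : 'I_q -> 'X_{1..r}) (sh' : 'I_q' -> 'X_{1..r}) beta
    (d : 'M[R]_(q', q)) (u : {ffun {set 'I_N} -> 'rV[R]_q'}) :
  (forall sigma f i j,
    hp beta (sigma + sh j)%MM (f * d i j) = hp beta (sigma + sh' i)%MM f * d i j) ->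
  chain_part sh beta (kmap (mulmxr d) u) = kmap (mulmxr d) (chain_part sh' beta u).
Proof.
move=> hd; apply/ffunP => T; apply/rowP => j.
rewrite ffunE !kmapE !mxE hp_sum; apply: eq_bigr => i _.
by rewrite ffunE !mxE hd.
Qed.

Lemma acyclic_rows q i (w : {ffun {set 'I_N} -> 'rV[R]_q}) :
  (0 < i)%N -> kdeg i w -> bd x w = 0 -> exists2 v, kdeg i.+1 v & w = bd x v.
Proof.
move=> i0 wi bw; apply: bd_row => j.
have wj : kdeg i (kmap (coor j) w) by move=> T Ti; rewrite kmapE wi // linear0.
have [|v vi hv] := x_acyclic i0 wj.
  by move=> T; rewrite bd_kmap bw kmapE ffunE linear0.
exists v => //; apply/eqP; rewrite -subr_eq0; apply/eqP/ffunP => T.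
by rewrite [RHS]ffunE; apply: hv.
Qed.

Variables (t : nat) (S : nat -> seq 'X_{1..r}).
Variable d : forall s, 'M[R]_(size (S s.+1), size (S s)).
Local Notation K s := {ffun {set 'I_N} -> 'rV[R]_(size (S s))}.
Local Notation sh s := (fun j : 'I_(size (S s)) => nth 0%MM (S s) j).
Hypothesis hp_d : forall beta s sigma f i j,
  hp beta (sigma + sh s j)%MM (f * d s i j) = hp beta (sigma + sh s.+1 i)%MM f * d s i j.
Hypothesis d_exact : forall s (v : 'rV[R]_(size (S s.+1))),
  v *m d s = 0 <-> exists u : 'rV[R]_(size (S s.+2)), u *m d s.+1 = v.

(** A diagram chase in the double complex of the resolution and the Koszul
    complex.  Going down, u lifts to chains of multidegree beta on the later
    terms of the resolution.  On the last term this is an element of F_t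
    of degree beta; as beta is not a shift of F_t, its coordinates have no
    constant term, so they lie in the ideal of [x] and the element is a Koszul
    boundary.  Going up again, the acyclicity of the Koszul complex in positive
    degrees makes every earlier lift a boundary too. *)
Lemma resolution_chase beta p s (u : K s) (u' : K s.+1) :
  (p + s)%N = t -> beta \notin S t ->
  kdeg p u -> chain_part (sh s) beta u = u -> kmap (mulmxr (d s)) u' = bd x u ->
  exists w : K s, exists2 w' : K s.+1,
    kdeg p.+1 w & u = bd x w + kmap (mulmxr (d s)) w'.
Proof.
move=> pst nbeta; elim: p s u u' pst => [|p IHp] s u u' pst ui hu hu'.
  have [w wi ->] : exists2 w, kdeg 1 w & u = bd x w.
    apply: bd_row => j; apply: bd_xideal.
      by move=> T Ti; rewrite kmapE ui // linear0.
    rewrite kmapE -hu ffunE /coor mxE; apply: hp_neq.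
    rewrite wt0 add0m; apply: contraNneq nbeta => <-.
    by rewrite -pst add0n mem_nth.
  exists w; exists 0 => //; rewrite -[LHS]addr0; congr (_ + _).
  by apply/ffunP => T; rewrite kmapE !ffunE linear0.
pose v := chain_part (sh s.+1) beta (kpart p u').
have vp : kdeg p v by apply: chain_part_kdeg; apply: kpart_deg.
have vE : kmap (mulmxr (d s)) v = bd x u.
  rewrite -(chain_part_kmap (sh := sh s)) //.
  have -> : kmap (mulmxr (d s)) (kpart p u') = kpart p (kmap (mulmxr (d s)) u').
    by apply/ffunP => T; rewrite kmapE !ffunE; case: ifP => //; rewrite linear0.
  by rewrite hu' kpart_id ?chain_part_bd ?hu //; apply: kdeg_bd.
have [v' v'E] : exists v' : K s.+2, kmap (mulmxr (d s.+1)) v' = bd x v.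
  have hT T : exists y, y *m d s.+1 = bd x v T.
    apply/d_exact; rewrite -[_ *m _]/(mulmxr (d s) _) -kmapE -bd_kmap vE.
    by rewrite bd_bd ffunE.
  have [v' v'E] := fin_all_exists hT; exists [ffun T : {set 'I_N} => v' T].
  by apply/ffunP => T; rewrite kmapE ffunE; apply: v'E.
have [|w [w' wp wE]] := IHp s.+1 v v' _ vp (chain_partK _ _ _) v'E.
  by rewrite -pst addnS.
have wK : kdeg p.+1 (u - kmap (mulmxr (d s)) w).
  by apply: kdegB => // T Tp; rewrite kmapE wp // linear0.
have wC : bd x (u - kmap (mulmxr (d s)) w) = 0.
  rewrite linearB /= bd_kmap -vE wE; apply/ffunP => T.
  rewrite !ffunE /= mulmxDl addrAC subrr add0r.
  have -> : w' T *m d s.+1 *m d s = 0 by apply/d_exact; exists (w' T).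
  by [].
have [y yi yE] := acyclic_rows (ltn0Sn p) wK wC.
by exists y; exists w => //; rewrite -yE subrK.
Qed.

End GradedResolution.

(** * Exterior products and the last shift *)
Section Wedge.
Variables (R : comNzRingType) (N : nat) (x : 'I_N -> R).
Variable a : 'I_N -> 'I_N -> R.
Local Notation K := {ffun {set 'I_N} -> R^o}.

(** The exterior product of the vectors sum_m a_(l,m) e_m for l in ls. *)
Definition wedge (ls : seq 'I_N) : K := foldr (fun l => ht (a l)) (kone R N) ls.

Lemma wedge_deg ls : kdeg (size ls) (wedge ls).
Proof. by elim: ls => [|l ls IHls] /=; [exact: kone_deg|exact: kdeg_ht]. Qed.

Lemma wedge_cycle (Q : R -> Prop) ls :
  ideal Q -> {in ls, forall l, Q (\sum_m a l m * x m)} -> kin Q (bd x (wedge ls)).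
Proof.
move=> hQ; elim: ls => [|l ls IHls] Ql /=.
  by rewrite (kdeg0_bd x (@kone_deg R N)) => T; rewrite ffunE; apply: (ideal0 hQ).
have Qbd : kin Q (bd x (wedge ls)).
  by apply: IHls => m ml; apply: Ql; rewrite inE ml orbT.
move=> T; have -> : bd x (ht (a l) (wedge ls)) =
    (\sum_m a l m * x m) *: wedge ls - ht (a l) (bd x (wedge ls)).
  by rewrite -bd_ht addrK.
rewrite !ffunE; apply: (idealB hQ); last exact: kin_ht.
by rewrite /GRing.scale /=; apply: ideal_mulr => //; apply: Ql; rewrite mem_head.
Qed.

(** Only the leading terms e_l contribute to the coefficient of the product at
    the set of all leading indices. *)
Lemma wedge_lead ls :
  uniq ls -> {in ls &, forall l m, a l m = (l == m)%:R} ->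
  exists e : nat, wedge ls [set l in ls] = (-1) ^+ e.
Proof.
elim: ls => [|l ls IHls] /= => [_ _|/andP [lls uls] al].
  by exists 0%N; rewrite ffunE (_ : [set l in [::]] = set0) ?eqxx //;
    apply/setP => l; rewrite !inE.
have [|e eE] := IHls uls; first by move=> i j il jl; apply: al; rewrite inE ?il ?jl orbT.
rewrite htE (bigD1 l) //= big1 ?addr0 => [|m ml].
  have -> : [set m in l :: ls] :\ l = [set m in ls].
    apply/setP => m; rewrite !inE; case: (m =P l) => //= ->.
    by rewrite (negPf lls).
  rewrite !inE eqxx eE /= al ?mem_head // eqxx scale1r /ksign.
  by eexists; rewrite /GRing.scale /= -exprD.
rewrite !inE (negPf ml) /=; case: ifP => mls; last by rewrite scaler0.
by rewrite al ?inE ?eqxx ?mls ?orbT // eq_sym (negPf ml) scale0r.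
Qed.

End Wedge.

(** For 0 -> R / Q -> R / I -> R / (I + F) -> 0, the connecting map
    H_(t+1) (R / (I + F)) -> H_t (R / Q) vanishes with its source, so
    that a class of H_t (R / Q) whose image in H_t (R / I) is zero is zero. *)
Lemma boundary_descent (R : comNzRingType) N (x : 'I_N -> R) (I Q : R -> Prop) F t
    (z w : {ffun {set 'I_N} -> R^o}) :
  ideal I -> (forall g, Q g <-> I (g * F)) -> acyclic x (adjoin I F) t.+1 ->
  kdeg t.+1 w -> kin I (F *: z - bd x w) ->
  exists v, kin Q (z - bd x v).
Proof.
move=> hI QI aJ wt zw.
have Jw : kin (adjoin I F) (bd x w).
  move=> T; exists (z T); have := idealN hI (zw T).
  by rewrite !ffunE /GRing.scale /= opprB mulrC.
have [y yt hy] := aJ w wt Jw.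
have [v vt hv] := kin_adjoin hI (kdegB wt (kdeg_bd x yt)) hy.
exists v => T; apply/QI; have := idealD hI (zw T) (kin_bd x hI hv T).
rewrite linearB /= linearB /= bd_bd subr0 linearZ /= !ffunE /GRing.scale /=.
by rewrite addrA subrK [_ * F]mulrC mulrBr.
Qed.

Section LastShift.
Variables (R : comNzRingType) (N r : nat) (x : 'I_N -> R).
Variable dx : 'I_N -> 'X_{1..r}.
Variable hp : 'X_{1..r} -> 'X_{1..r} -> R -> R.
Implicit Types (T : {set 'I_N}) (beta sigma : 'X_{1..r}).
Hypothesis hpB : forall beta sigma, {morph hp beta sigma : f g / f - g}.
Hypothesis hpK : forall beta sigma f, hp beta sigma (hp beta sigma f) = hp beta sigma f.
Hypothesis hp_x : forall beta sigma l f,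
  hp beta sigma (x l * f) = x l * hp beta (dx l + sigma)%MM f.
Hypothesis hp_neq : forall beta sigma f, sigma != beta -> xideal x (hp beta sigma f).
Hypothesis x_acyclic : forall i, (0 < i)%N -> acyclic x (fun f => f = 0) i.

Lemma hp_wedge (a : 'I_N -> 'I_N -> R) F alpha ls :
  hp alpha 0%MM F = F ->
  (forall l m beta sigma f, l \in ls ->
    hp (dx l + beta)%MM (dx m + sigma)%MM (a l m * f) = a l m * hp beta sigma f) ->
  forall T, hp (alpha + \sum_(l <- ls) dx l)%MM (wt dx T) (F * wedge a ls T) =
    F * wedge a ls T.
Proof.
move=> hF; elim: ls => [|l ls IHls] ha T.
  rewrite big_nil addm0 /= ffunE; case: eqP => [->|_].
    by rewrite mulr1 wt0.
  by rewrite mulr0 (hp0 hpB).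
have {}IHls := IHls (fun l' m beta sigma f h => ha l' m beta sigma f (@mem_behead _ (l :: ls) _ h)).
rewrite /= htE !mulr_sumr (hp_sum hpB); apply: eq_bigr => m _.
case: ifP => mT; last by rewrite scaler0 mulr0 (hp0 hpB).
rewrite big_cons /GRing.scale /= mulrCA -{1}(setD1K mT) wtU1 ?setD11 //.
rewrite addmA [(alpha + dx l)%MM]addmC -addmA ha ?mem_head //; congr (_ * _).
rewrite mulrCA /ksign -signr_odd mulr_sign; case: (odd _); rewrite ?(hpN hpB) IHls //.
Qed.

Variables (t : nat) (S : nat -> seq 'X_{1..r}).
Variable d : forall s, 'M[R]_(size (S s.+1), size (S s)).
Hypothesis hp_d : forall beta s sigma f (i : 'I_(size (S s.+1))) (j : 'I_(size (S s))),
  hp beta (sigma + nth 0%MM (S s) j)%MM (f * d s i j) =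
  hp beta (sigma + nth 0%MM (S s.+1) i)%MM f * d s i j.
Hypothesis d_exact : forall s (v : 'rV[R]_(size (S s.+1))),
  v *m d s = 0 <-> exists u : 'rV[R]_(size (S s.+2)), u *m d s.+1 = v.
Hypothesis S0 : S 0%N = [:: 0%MM].
Variable I : R -> Prop.
Hypothesis hI : ideal I.
Hypothesis d_exact0 : forall f,
  I f <-> exists u : 'rV[R]_(size (S 1%N)), u *m d 0%N = const_mx f.

(** A boundary modulo Q has its coefficients in Q + (x), so z is none, and the
    class of F z in H_t (R / I) is not zero either.  This homology is
    Tor_t (R / I, R / (x)), whose degrees are shifts of the last term of the
    resolution. *)
Lemma last_shift (Q : R -> Prop) F beta (z : {ffun {set 'I_N} -> R^o}) T0 :
  ideal Q -> (forall g, Q g <-> I (g * F)) -> acyclic x (adjoin I F) t.+1 ->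
  kdeg t z -> kin Q (bd x z) ->
  (forall T, hp beta (wt dx T) (F * z T) = F * z T) ->
  (forall g, xideal x g -> ~ Q (z T0 - g)) ->
  beta \in S t.
Proof.
move=> hQ QI aJ zt Qz hz nz; apply/negP => /negP nbeta.
pose u : {ffun {set 'I_N} -> 'rV[R]_(size (S 0%N))} :=
  [ffun T : {set 'I_N} => const_mx (F * z T)].
have ucoor j : kmap (coor j) u = F *: z.
  by apply/ffunP => T; rewrite kmapE !ffunE /coor mxE.
have bdu T : bd x u T = const_mx (F * bd x z T).
  apply/rowP => j; rewrite -[LHS]/(coor j (bd x u T)) -kmapE -bd_kmap ucoor.
  by rewrite linearZ ffunE mxE.
have [u' u'E] : exists u' : {ffun {set 'I_N} -> 'rV[R]_(size (S 1%N))},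
    kmap (mulmxr (d 0%N)) u' = bd x u.
  have hT T : exists y, y *m d 0%N = bd x u T.
    by rewrite bdu; apply/d_exact0; rewrite mulrC; apply/QI/Qz.
  have [u' u'E] := fin_all_exists hT; exists [ffun T : {set 'I_N} => u' T].
  by apply/ffunP => T; rewrite kmapE ffunE; apply: u'E.
have j00 (j : 'I_(size (S 0%N))) : j = 0%N :> nat.
  by move: (nat_of_ord j) (ltn_ord j) => i; rewrite S0; case: i.
have udeg : kdeg t u.
  by move=> T Tt; apply/rowP => j; rewrite ffunE !mxE zt // mulr0.
have uhom : chain_part dx hp (fun j => nth 0%MM (S 0%N) j) beta u = u.
  apply/ffunP => T; apply/rowP => j; rewrite !ffunE !mxE.
  by rewrite j00 [nth _ _ _](_ : _ = 0%MM) ?addm0 // S0.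
have [w [w' wt uE]] :=
  resolution_chase hpB hpK hp_x hp_neq x_acyclic hp_d d_exact (addn0 t) nbeta udeg uhom u'E.
have s1 : (0 < size (S 0%N))%N by rewrite S0.
pose j0 := Ordinal s1.
have jj0 j : j = j0 by apply/val_inj; rewrite /= j00.
have wj : kdeg t.+1 (kmap (coor j0) w) by move=> T Tt; rewrite kmapE wt // linear0.
have zw : kin I (F *: z - bd x (kmap (coor j0) w)).
  move=> T; apply/d_exact0; exists (w' T).
  rewrite -(ucoor j0) {1}uE bd_kmap; apply/rowP => j; rewrite (jj0 j).
  by rewrite [RHS]mxE !ffunE /coor !mxE addrAC subrr add0r.
have [v hv] := boundary_descent hI QI aJ wj zw.
apply: (nz (bd x v T0)); last by have := hv T0; rewrite !ffunE.
exists (fun l => if l \in T0 then 0 else ksign R l T0 *: v (l |: T0)).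
by rewrite bdE; apply: eq_bigr => l _; rewrite mulrC.
Qed.

End LastShift.

(** * The length of regular sequences *)
Section RegularBound.
Variables (k : fieldType) (N : nat).
Local Notation R := {mpoly k[N]}.
Implicit Types (I : R -> Prop).

Definition independent I (J : finType) (m : J -> R) :=
  forall c : J -> k, I (\sum_j c j *: m j) -> forall j, c j = 0.

Definition degle n (u : nat) (f : {mpoly k[n]}) := {in msupp f, forall m, (mdeg m <= u)%N}.

Lemma degleM u v (f g : R) : degle u f -> degle v g -> degle (u + v) (f * g).
Proof.
move=> fu gv m /msuppM_le /allpairsP [[m1 m2] /= [/fu h1 /gv h2 ->]].
by rewrite mdegD leq_add.
Qed.

Lemma degleX u (f : R) i : degle u f -> degle (i * u) (f ^+ i).
Proof.
move=> fu; elim: i => [|i IHi]; first last.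
  by rewrite exprS mulSn; apply: degleM.
by move=> m; rewrite expr0 msupp1 inE => /eqP ->; rewrite mdeg0.
Qed.

Lemma degleW u v n (f : {mpoly k[n]}) : (u <= v)%N -> degle u f -> degle v f.
Proof. by move=> uv fu m /fu /leq_trans; apply. Qed.

(** In a linear relation sum_i f^i g_i with the g_i in the span of [m], the
    coefficients of g_0 vanish by independence modulo I + (f); then f can be
    cancelled, and the argument repeats. *)
Lemma independent_powers I (J : finType) (m : J -> R) f D :
  ideal I -> nzdiv I f -> independent (adjoin I f) m ->
  independent I (fun p : 'I_D * J => f ^+ p.1 * m p.2).
Proof.
move=> hI fI im.
have sumE D' (c : 'I_D' * J -> k) : \sum_p c p *: (f ^+ p.1 * m p.2) =
    \sum_(i < D') \sum_j c (i, j) *: (f ^+ i * m j).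
  by rewrite pair_bigA; apply: eq_bigr => -[].
elim: D => [|D IHD] c; first by move=> _ [[]].
rewrite sumE big_ord_recl /=.
pose X := \sum_(p : 'I_D * J) c (lift ord0 p.1, p.2) *: (f ^+ p.1 * m p.2).
have -> : \sum_(i < D) \sum_j c (lift ord0 i, j) *: (f ^+ bump 0 i * m j) = X * f.
  rewrite /X (sumE _ (fun p => c (lift ord0 p.1, p.2))) mulr_suml.
  apply: eq_bigr => i _; rewrite mulr_suml; apply: eq_bigr => j _.
  by rewrite -scalerAl /bump add1n exprS -mulrA [f * _]mulrC.
under eq_bigr => j _ do rewrite expr0 mul1r.
move=> IX; have c0 j : c (ord0, j) = 0.
  apply: (im (fun j => c (ord0, j))).
  by exists (- X); rewrite mulNr opprK.
have cS : forall p : 'I_D * J, c (lift ord0 p.1, p.2) = 0.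
  apply: (IHD (fun p => c (lift ord0 p.1, p.2))); apply: fI; move: IX.
  by rewrite big1 ?add0r // => j _; rewrite c0 scale0r.
case=> i j; case: (unliftP ord0 i) => [i' ->|->]; last exact: c0.
exact: cS (i', j).
Qed.

Lemma regular_independent (s : seq R) : forall I d D, ideal I ->
  {in s, forall f, degle d f} -> wreg s I -> ~ add_gens I s 1 ->
  exists (J : finType) (m : J -> R),
    [/\ #|J| = (D ^ size s)%N, independent I m &
        forall j, degle (size s * (D * d)) (m j)].
Proof.
elim: s => [|f s IHs] I d D hI sd.
  move=> _ n1; exists unit, (fun=> 1); split=> [|c|j]; first by rewrite card_unit.
    rewrite (bigD1 tt) //= big1 => [|[] //]; rewrite addr0 => Ic [].
    apply/eqP; apply: contra_notT n1 => c0; apply/(add_gens_nil _ hI).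
    by rewrite -[1](scalerK c0) -mul_mpolyC; apply: (idealM hI).
  by move=> m; rewrite msupp1 inE => /eqP ->; rewrite mdeg0.
move=> [fI sI] n1; have hJ := adjoin_ideal f hI.
have [||J [m [cJ im md]]] := IHs _ d D hJ _ sI.
- by move=> g gs; apply: sd; rewrite inE gs orbT.
- by move=> h; apply: n1; apply/(add_gens_cons _ _ _ hI).
exists ('I_D * J)%type, (fun p : 'I_D * J => f ^+ p.1 * m p.2); split.
- by rewrite card_prod card_ord cJ expnS.
- exact: independent_powers.
- move=> [i j] /=; rewrite mulSn; apply: degleM => //.
  apply: (@degleW (i * d)); first by rewrite leq_mul2r ltnW ?orbT.
  by apply: degleX; apply: sd; rewrite mem_head.
Qed.

Variables (r : nat) (Y : finType) (phi : Y -> {linear R -> {mpoly k[r]}}).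

(** The coefficients of the images under the [phi y] are |Y| (u+1)^r linear
    conditions, which only elements of I satisfy. *)
Lemma independent_bound I (J : finType) (m : J -> R) u :
  (forall f, (forall y, phi y f = 0) -> I f) ->
  (forall y f, degle u f -> degle u (phi y f)) ->
  independent I m -> (forall j, degle u (m j)) ->
  (#|J| <= #|Y| * u.+1 ^ r)%N.
Proof.
move=> phiI phid im mu; pose W := (Y * {ffun 'I_r -> 'I_u.+1})%type.
have cW : #|{: W}| = (#|Y| * u.+1 ^ r)%N by rewrite card_prod card_ffun !card_ord.
rewrite -cW leqNgt; apply/negP => lt.
pose mon (g : {ffun 'I_r -> 'I_u.+1}) : 'X_{1..r} := [multinom (g a : nat) | a < r].
pose ent j (w : W) : k := (phi w.1 (m j))@_(mon w.2).
pose M : 'M[k]_(#|J|, #|{: W}|) := \matrix_(i, w) ent (enum_val i) (enum_val w).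
have /rowV0Pn [v /sub_kermxP vM v0] : kermx M != 0.
  rewrite -mxrank_eq0 mxrank_ker -lt0n subn_gt0.
  exact: leq_ltn_trans (rank_leq_col _) lt.
have c0 : forall j, v 0 (enum_rank j) = 0.
  apply: (im (fun j => v 0 (enum_rank j))); apply: phiI => y.
  apply/mpolyP => b; rewrite mcoeff0 linear_sum raddf_sum /=.
  have [bu|] := boolP [forall a, (b a < u.+1)%N]; last first.
    rewrite negb_forall => /existsP [a ba]; rewrite big1 // => j _.
    rewrite linearZ mcoeffZ /= [X in _ * X]memN_msupp_eq0 ?mulr0 //.
    apply: contra ba => /(phid _ _ (mu j)) bu; rewrite ltnS (leq_trans _ bu) //.
    by rewrite mdegE (bigD1 a) //= leq_addr.
  pose w : W := (y, [ffun a => inord (b a)]).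
  have := congr1 (fun X : 'rV_ _ => X 0 (enum_rank w)) vM.
  rewrite !mxE => wM; rewrite -[RHS]wM (reindex (@enum_rank J)) /=; last first.
    exact: onW_bij (enum_rank_bij _).
  apply: eq_bigr => j _; rewrite linearZ mcoeffZ /= mxE !enum_rankK /ent /=.
  congr (_ * _@_ _); apply/mnmP => a; rewrite mnmE ffunE inordK //.
  exact: (forallP bu).
case/negP: v0; apply/eqP/rowP => i; rewrite mxE -[i]enum_valK; exact: c0.
Qed.

(** A regular sequence of length e yields D ^ e independent elements of degree
    O(D), whereas R / I has at most O(D ^ r) of them. *)
Lemma regular_bound I (s : seq R) : ideal I ->
  (forall f, (forall y, phi y f = 0) -> I f) ->
  (forall u y f, degle u f -> degle u (phi y f)) ->
  wreg s I -> ~ add_gens I s 1 -> (size s <= r)%N.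
Proof.
move=> hI phiI phid sI n1; rewrite leqNgt; apply/negP => lt.
pose d := \max_(f <- s) msize f.
have sd : {in s, forall f, degle d f}.
  move=> f fs m mf; apply: ltnW; apply: leq_trans (msize_mdeg_lt mf) _.
  exact: (@leq_bigmax_seq _ _ xpredT).
(* The bound |Y| (e D d + 1)^r is at most C D^r, which is less than D^(r+1). *)
pose C := (#|Y| * (size s * d).+1 ^ r)%N; pose D := C.+1.
have [J [m [cJ im md]]] := regular_independent D hI sd sI n1.
have := independent_bound phiI (phid _) im md; rewrite cJ leqNgt => /negP; apply.
apply: leq_trans (_ : D ^ r.+1 <= _)%N; last by rewrite leq_pexp2l.
rewrite expnS; apply: leq_ltn_trans (_ : C * D ^ r < _)%N; last first.
  by rewrite ltn_mul2r expn_gt0 /= ltnSn.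
rewrite /C -mulnA leq_mul2l -expnMn; apply/orP; right.
case: (r) => // r'; rewrite leq_exp2r //.
by rewrite mulnCA [X in (_ < X)%N]mulnC mulnS addnC -addn1 leq_add2l.
Qed.

End RegularBound.

(** * Restriction to the cone over a point *)
Section PointEvaluation.
Variables (k : fieldType) (N r : nat) (vtag : 'I_N -> 'I_r).
Local Notation R := {mpoly k[N]}.
Local Notation P := {mpoly k[r]}.
Implicit Types (m : 'X_{1..N}) (v : 'I_N -> k).

(** The multidegree, for any assignment of the variables to the r factors. *)
Definition md m : 'X_{1..r} := [multinom (\sum_(l | vtag l == i) m l)%N | i < r].

Lemma mdD m m' : md (m + m')%MM = (md m + md m')%MM.
Proof.
apply/mnmP => i; rewrite mnmDE !mnmE -big_split; apply: eq_bigr => l _.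
by rewrite mnmDE.
Qed.

Lemma mdU l : md U_(l)%MM = U_(vtag l)%MM.
Proof.
apply/mnmP => i; rewrite mnmE mnm1E big_mkcond (bigD1 l) //= big1 => [|l' l'l].
  by rewrite mnm1E eqxx addn0; case: eqP.
by rewrite mnm1E [l == _]eq_sym (negPf l'l) if_same.
Qed.

Lemma mdeg_md m : mdeg (md m) = mdeg m.
Proof.
rewrite !mdegE (partition_big vtag predT) //=; apply: eq_bigr => i _.
by rewrite mnmE.
Qed.

Lemma md_eq0 m : (md m == 0%MM) = (m == 0%MM).
Proof. by rewrite -!mdeg_eq0 mdeg_md. Qed.

(** Restriction of a polynomial to the cone of all (a_1 v_1, ..., a_r v_r) over
    the point v, with the scalars a_1, ..., a_r as new variables. *)
Definition pev v : R -> P := mmap (@mpolyC r k) (fun l => (v l)%:MP * 'X_(vtag l)).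

HB.instance Definition _ v := GRing.RMorphism.on (pev v).

Lemma pevZ v c f : pev v (c *: f) = c *: pev v f.
Proof. by rewrite /pev mmapZ mul_mpolyC. Qed.

Lemma pev_is_scalable v : scalable (pev v).
Proof. by move=> c f; rewrite pevZ. Qed.

HB.instance Definition _ v := GRing.isScalable.Build k R P _ (pev v) (pev_is_scalable v).

Lemma pev_sum v (I : Type) (s : seq I) (p : pred I) (F : I -> R) :
  pev v (\sum_(i <- s | p i) F i) = \sum_(i <- s | p i) pev v (F i).
Proof. exact: raddf_sum. Qed.

Lemma pevXU v l : pev v 'X_l = v l *: 'X_(vtag l).
Proof. by rewrite /pev mmapX mmap1U mul_mpolyC. Qed.

Lemma pevX v m : pev v 'X_[m] = (\prod_l v l ^+ m l) *: 'X_[md m].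
Proof.
rewrite /pev mmapX /mmap1.
rewrite (eq_bigr (fun l => v l ^+ m l *: ('X_(vtag l) : P) ^+ m l)) => [|l _]; last first.
  by rewrite mul_mpolyC exprZn.
rewrite scaler_prod; congr (_ *: _).
have -> : md m = (\sum_l U_(vtag l) *+ m l)%MM.
  apply/mnmP => i; rewrite mnmE mnm_sumE big_mkcond; apply: eq_bigr => l _.
  by rewrite mulmnE mnm1E; case: eqP; rewrite ?mul1n ?mul0n.
by rewrite mprodXnE.
Qed.

Lemma mcoeff_pev v f b : (pev v f)@_b = (mpart (fun m => md m == b) f).@[v].
Proof.
rewrite {1}(mpolyE f) pev_sum (raddf_sum (mcoeff b)) [in RHS](mpolyE f).
rewrite mpart_sum (raddf_sum (meval v)) /=.
apply: eq_bigr => m _.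
rewrite pevZ pevX !mcoeffZ mcoeffX linearZ mevalZ /= mpartX mevalZ mevalX.
by rewrite [_%:R * _]mulrC.
Qed.

Lemma pev_homog v f a : {in msupp f, forall m, md m = a} ->
  pev v f = f.@[v] *: 'X_[a].
Proof.
move=> fa; apply/mpolyP => b; rewrite mcoeff_pev mcoeffZ mcoeffX.
case: (a =P b) => [<-|nab].
  by rewrite mulr1 mpart_id // => m /fa ->.
rewrite mulr0 (_ : mpart _ f = 0) ?meval0 //; apply/mpolyP => m.
rewrite mcoeff_mpart mcoeff0; case: eqP => // mb.
by apply/eqP; rewrite mcoeff_eq0; apply/negP => /fa ma; rewrite ma in mb.
Qed.

Lemma pev_mpart v f a : pev v f = 0 -> pev v (mpart (fun m => md m == a) f) = 0.
Proof.
move=> f0; rewrite (@pev_homog v _ a) => [|m /mpart_supp /eqP //].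
by rewrite -mcoeff_pev f0 mcoeff0 scale0r.
Qed.

Lemma degle_pev v u f : degle u f -> degle u (pev v f).
Proof.
move=> fu b; rewrite mcoeff_msupp mcoeff_pev; apply: contraR => bu.
rewrite (_ : mpart _ f = 0) ?meval0 //; apply/mpolyP => m.
rewrite mcoeff_mpart mcoeff0; case: eqP => // mb; apply/eqP; rewrite mcoeff_eq0.
by apply: contra bu => /fu; rewrite -mb mdeg_md.
Qed.

Lemma mcoeff0_pev v f : (pev v f)@_0%MM = f@_0%MM.
Proof.
rewrite mcoeff_pev; transitivity ((f@_0%MM)%:MP_[N].@[v]); last by rewrite mevalC.
congr (_.@[v]); apply/mpolyP => m; rewrite mcoeff_mpart mcoeffC md_eq0.
by case: eqP => [->|]; rewrite ?mulr1 ?mulr0.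
Qed.

Section Pivot.
Variables (v : 'I_N -> k) (piv : 'I_r -> 'I_N).
Hypothesis vtag_piv : forall i, vtag (piv i) = i.
Hypothesis v_piv : forall i, v (piv i) != 0.

Definition cone_coord i : R := (v (piv i))^-1 *: 'X_(piv i).

Lemma pev_cone_coord i : pev v (cone_coord i) = 'X_i.
Proof. by rewrite /cone_coord pevZ pevXU scalerA mulVf // scale1r vtag_piv. Qed.

Definition cone_lift : P -> R := mmap (@mpolyC N k) cone_coord.

Lemma cone_liftK : cancel cone_lift (pev v).
Proof.
move=> g; rewrite {2}(mpolyE g) /cone_lift /mmap raddf_sum /=; apply: eq_bigr => m _.
rewrite mul_mpolyC pevZ /mmap1 rmorph_prod /= mpolyXE_id; congr (_ *: _).
by apply: eq_bigr => i _; rewrite rmorphXn /= pev_cone_coord.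
Qed.

Lemma pev_ideal : ideal (fun f : R => pev v f = 0).
Proof.
split; first exact: rmorph0.
  by move=> a b a0 b0; rewrite rmorphD /= a0 b0 addr0.
by move=> c a a0; rewrite rmorphM /= a0 mulr0.
Qed.

Lemma pev_wreg : wreg [seq cone_coord i | i <- enum 'I_r] (fun f : R => pev v f = 0).
Proof.
apply: (wreg_preim (J := fun g => g = 0) cone_liftK).
rewrite -map_comp (eq_map (g := fun i => 'X_i)); first exact: wreg_vars.
by move=> i /=; rewrite pev_cone_coord.
Qed.

(** The linear forms that restrict to the r coordinates of the cone over P are
    a regular sequence on R / I_P. *)
Lemma pev_acyclic i : (N < i + r)%N ->
  acyclic (fun l => 'X_l : R) (fun f : R => pev v f = 0) i.
Proof.
move=> Ni; apply: (acyclic_wreg pev_ideal _ pev_wreg).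
  move=> _ /mapP [j _ ->]; apply/xideal_vars.
  by rewrite mcoeffZ mcoeffX mnm1_eq0 mulr0.
by rewrite size_map size_enum_ord.
Qed.

(** Row l holds the coefficients of X_l - (v_l / v_p) X_p, where p is the pivot
    of the factor of l.  For l not a pivot these t linear forms generate the
    ideal of the cone. *)
Definition cone_form (l m : 'I_N) : R :=
  ((m == l)%:R - (if m == piv (vtag l) then v l / v m else 0))%:MP.

Lemma cone_form_vanish l : l != piv (vtag l) ->
  pev v (\sum_l' cone_form l l' * 'X_l') = 0.
Proof.
move=> lp; rewrite raddf_sum /= (bigD1 l) //= (bigD1 (piv (vtag l))) /=; last by rewrite eq_sym.
rewrite big1 => [|m /andP [/negPf ml /negPf mp]]; last first.
  by rewrite /cone_form ml mp subrr mpolyC0 mul0r rmorph0.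
rewrite /cone_form !eqxx (negPf lp) [piv _ == l]eq_sym (negPf lp) subr0 sub0r addr0.
rewrite !mul_mpolyC !pevZ !pevXU vtag_piv !scalerA -scalerDl.
by rewrite mul1r mulNr divfK // subrr scale0r.
Qed.

Definition nonpivots : seq 'I_N := [seq l <- enum 'I_N | l != piv (vtag l)].

Lemma cone_form_lead : {in nonpivots &, forall l l', cone_form l l' = (l == l')%:R}.
Proof.
move=> l m _; rewrite mem_filter => /andP [mp _]; rewrite /cone_form.
rewrite [m == l]eq_sym; case: (m =P piv _) => [mE|_]; last by rewrite subr0 mpolyC_nat.
by case/negP: mp; rewrite {1}mE mE vtag_piv.
Qed.

Variable n : 'I_r -> nat.
Hypothesis card_vtag : forall i, #|[pred l | vtag l == i]| = (n i).+1.

Lemma sum_nonpivots : (\sum_(l <- nonpivots) U_(vtag l))%MM = [multinom n i | i < r].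
Proof.
apply/mnmP => i; rewrite mnm_sumE mnmE big_filter big_enum_cond /=.
apply/eqP; rewrite -eqSS -card_vtag -sum1_card [X in _ == X](bigD1 (piv i)) /=; last first.
  by rewrite inE vtag_piv.
rewrite add1n eqSS; apply/eqP.
under eq_bigr => l _ do rewrite mnm1E.
rewrite big_mkcond [RHS]big_mkcond; apply: eq_bigr => l _; rewrite inE.
by case: (vtag l =P i) => [->|_]; rewrite ?if_same.
Qed.

Lemma size_nonpivots : size nonpivots = (\sum_(i < r) n i)%N.
Proof.
have := congr1 mdeg sum_nonpivots; rewrite mdeg_sum mdegE => E.
under [RHS]eq_bigr => i _ do rewrite -(mnmE n).
rewrite -E; under eq_bigr => l _ do rewrite mdeg1.
by rewrite sum1_size.
Qed.

Lemma card_vars : N = (\sum_(i < r) n i + r)%N.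
Proof.
rewrite -[LHS]card_ord -sum1_card (partition_big vtag predT) //=.
under eq_bigr => i _ do rewrite sum1_card card_vtag -addn1.
by rewrite big_split /= sum1_card card_ord.
Qed.

End Pivot.

(** The part of f of multidegree beta - sigma, without the subtraction. *)
Definition mdpart (beta sigma : 'X_{1..r}) (f : R) : R :=
  mpart (fun m => (md m + sigma)%MM == beta) f.

Lemma mdpartB beta sigma : {morph mdpart beta sigma : f g / f - g}.
Proof. by move=> f g; apply: raddfB. Qed.

Lemma mdpartK beta sigma f : mdpart beta sigma (mdpart beta sigma f) = mdpart beta sigma f.
Proof. by rewrite {1}/mdpart mpart_id // => m /mpart_supp. Qed.

Lemma mdpart_x beta sigma l f :
  mdpart beta sigma ('X_l * f) = 'X_l * mdpart beta (U_(vtag l) + sigma)%MM f.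
Proof.
rewrite mulrC [RHS]mulrC; apply: mpartM => m /mem_msuppXP <- m'.
by rewrite mdD mdU addmA.
Qed.

Lemma mdpart_neq beta sigma f : sigma != beta ->
  xideal (fun l => 'X_l : R) (mdpart beta sigma f).
Proof.
move=> ne; apply/xideal_vars; rewrite mcoeff_mpart.
have /eqP -> : md 0%MM == 0%MM by rewrite md_eq0.
by rewrite add0m (negPf ne).
Qed.

Lemma mdpart_cone_form v piv l l' beta sigma f : (forall i, vtag (piv i) = i) ->
  mdpart (U_(vtag l) + beta)%MM (U_(vtag l') + sigma)%MM (cone_form v piv l l' * f) =
  cone_form v piv l l' * mdpart beta sigma f.
Proof.
move=> vtag_piv; rewrite /cone_form !mul_mpolyC /mdpart linearZ /=.
case: (vtag l' =P vtag l) => [->|ne].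
  congr (_ *: _); apply: eq_bigl => m.
  by rewrite addmA [(md m + _)%MM]addmC -addmA eqm_add2l.
have -> : (l' == l) = false by apply/eqP => ll'; rewrite ll' in ne.
have -> : (l' == piv (vtag l)) = false by apply/eqP => E; rewrite E vtag_piv in ne.
by rewrite subrr !scale0r.
Qed.

End PointEvaluation.

(** * Points, their ideals and separators *)
Lemma meval_pev (k : fieldType) N r (vtag : 'I_N -> 'I_r) (v : 'I_N -> k)
    (c : 'I_r -> k) f :
  (pev vtag v f).@[c] = f.@[fun l => v l * c (vtag l)].
Proof.
rewrite {1}(mpolyE f) pev_sum (raddf_sum (meval c)) mevalE.
apply: eq_bigr => m _; rewrite pevZ pevX /= !mevalZ mevalX; congr (_ * _).
under [RHS]eq_bigr => l _ do rewrite exprMn.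
rewrite big_split /=; congr (_ * _); rewrite [RHS](partition_big vtag predT) //=.
apply: eq_bigr => i _; rewrite mnmE -prodrXr; apply: eq_bigr => l /eqP <- //.
Qed.

Section Points.
Variables (k : fieldType) (r : nat) (n : 'I_r -> nat).
Local Notation N := #|mvar n|.
Local Notation R := {mpoly k[N]}.
Implicit Types (P Q : mproj k n) (X Y : {fset mproj k n}).

Definition vtag (l : 'I_N) : 'I_r := tag (enum_val l : mvar n).

Lemma multidegE m : multideg m = md vtag m.
Proof.
apply/mnmP => i; rewrite !mnmE.
rewrite (reindex_onto (@enum_rank (mvar n)) enum_val) /=; last by move=> l _; rewrite enum_valK.
rewrite [RHS](eq_bigl (fun y : mvar n => tag y == i)) => [|y]; last first.
  by rewrite /vtag enum_rankK eqxx andbT.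
transitivity (\sum_(i' | i' == i) \sum_(j < (n i').+1) m (mvar_rank j))%N.
  by rewrite big_pred1_eq.
rewrite sig_big_dep /=; apply: eq_big => [[a b]|[a b] _] //=.
by rewrite andbT.
Qed.

Lemma card_vtag i : #|[pred l | vtag l == i]| = (n i).+1.
Proof.
have [m m1] : exists m : 'X_{1..N}, forall l, m l = 1%N.
  by exists [multinom 1%N | _ < N] => l; rewrite mnmE.
transitivity (multideg m i).
  by rewrite multidegE mnmE -sum1_card; apply: eq_bigr => l _; exact/esym/m1.
rewrite mnmE (eq_bigr (fun=> 1%N)) => [|j _]; last exact: m1.
by rewrite sum1_card card_ord.
Qed.

Definition coords (v : forall i : 'I_r, 'rV[k]_(n i).+1) (l : 'I_N) : k :=
  v (vtag l) ord0 (tagged (enum_val l : mvar n)).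

Definition rep P i : 'rV[k]_(n i).+1 := vpick (val (P i)).

Lemma rep_is_rep P : is_rep P (rep P).
Proof.
move=> i; rewrite /rep memv_pick vpick0; split=> //.
by rewrite -dimv_eq0 (eqP (valP (P i))).
Qed.

Definition pt P : 'I_N -> k := coords (rep P).

Lemma vanishes_pev P a f :
  {in msupp f, forall m, md vtag m = a} ->
  vanishes_at f P <-> pev vtag (pt P) f = 0.
Proof.
move=> fa; split=> [|f0 v vP].
  by move/(_ _ (rep_is_rep P)) => f0; rewrite (pev_homog _ fa) [_.@[_]]f0 scale0r.
have [c vE] : exists c : 'I_r -> k, forall i, v i = c i *: rep P i.
  have hi i : exists c, v i = c *: rep P i.
    have [_ vi] := vP i; have [r0 ri] := rep_is_rep P i.
    have : (<[rep P i]> == val (P i))%VS.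
      by rewrite eqEdim -memvE ri dim_vline r0 (eqP (valP (P i))).
    by move/eqP => E; move: vi; rewrite -E => /vlineP.
  by have [c cE] := fin_all_exists hi; exists c.
rewrite /eval_at; transitivity ((pev vtag (pt P) f).@[c]); last by rewrite f0 meval0.
rewrite meval_pev; apply: meval_eq => l; rewrite /pt /coords -/(vtag l) vE mxE mulrC //.
Qed.

Lemma pt_pivots P : exists piv : 'I_r -> 'I_N,
  (forall i, vtag (piv i) = i) /\ (forall i, pt P (piv i) != 0).
Proof.
have h i : exists l : 'I_N, vtag l = i /\ pt P l != 0.
  have [/rV0Pn [j rj] _] := rep_is_rep P i.
  by exists (mvar_rank j); rewrite /pt /coords /vtag /mvar_rank enum_rankK.
have [piv pivP] := fin_all_exists h.
by exists piv; split=> i; have [] := pivP i.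
Qed.

Lemma ideal_point X : ideal (point_ideal X : R -> Prop).
Proof. exact: gen_ideal_ideal. Qed.

(** A form lies in I_X iff it vanishes on the cones over the points of X: the
    multihomogeneous components of such a form vanish there too. *)
Lemma point_idealP X (f : R) :
  point_ideal X f <-> {in X, forall Q, pev vtag (pt Q) f = 0}.
Proof.
split=> [fX Q QX|f0].
  move: f fX; apply: (gen_ideal_min (pev_ideal vtag (pt Q))) => f [[a fa] fX].
  by apply/(@vanishes_pev _ a) => [m /fa|]; [rewrite multidegE|apply: fX].
have -> : f = \sum_(b <- undup [seq md vtag m | m <- msupp f])
    mpart (fun m => md vtag m == b) f.
  apply/mpolyP => m; rewrite raddf_sum /=.
  have [mf|mf] := boolP (m \in msupp f); last first.
    rewrite memN_msupp_eq0 // big1 // => b _.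
    by rewrite mcoeff_mpart memN_msupp_eq0 // if_same.
  rewrite (bigD1_seq (md vtag m)) ?undup_uniq ?mem_undup ?map_f //=.
  rewrite mcoeff_mpart eqxx big1 ?addr0 // => b; rewrite mcoeff_mpart eq_sym.
  by move=> /negPf ->.
apply: ideal_sum => [|b _]; first exact: ideal_point.
apply: gen_ideal_sub.
have hb : {in msupp (mpart (fun m => md vtag m == b) f), forall m, md vtag m = b}.
  by move=> m /mpart_supp /eqP.
split; first by exists b => m /hb; rewrite multidegE.
by move=> Q /f0 Q0; apply/(vanishes_pev _ hb); apply: pev_mpart.
Qed.

Lemma irrelevant_xideal (f : R) :
  irrelevant (n := n) f <-> xideal (fun l => 'X_l : R) f.
Proof.
split.
  apply: gen_ideal_min; first exact: xideal_ideal.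
  by move=> _ [l ->]; apply/xideal_vars; rewrite mcoeffX mnm1_eq0.
have hI : ideal (irrelevant (n := n) : R -> Prop) by exact: gen_ideal_ideal.
case=> g ->; apply: ideal_sum => // l _; apply: (idealM hI).
by apply: gen_ideal_sub; exists l.
Qed.

(** Both the ideal of a nonempty set of points and s consist of polynomials
    without constant term. *)
Lemma point_ideal_proper X Q (s : seq R) : Q \in X ->
  {in s, forall f, irrelevant (n := n) f} -> ~ add_gens (point_ideal X) s 1.
Proof.
move=> QX sm.
have h0 : ideal (fun f : R => f@_0%MM = 0).
  split; first by rewrite mcoeff0.
    by move=> a b a0 b0; rewrite mcoeffD a0 b0 addr0.
  by move=> c a a0; rewrite rmorphM /= a0 mulr0.
suff h f : add_gens (point_ideal X) s f -> f@_0%MM = 0.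
  by move/h/eqP; rewrite mcoeff1 eqxx oner_eq0.
apply: (gen_ideal_min h0) => {}f [/point_idealP /(_ Q QX) f0|/sm /irrelevant_xideal].
  by rewrite -(mcoeff0_pev vtag (pt Q)) f0 mcoeff0.
by move/xideal_vars.
Qed.

Lemma regular_seq_acyclic X (s : seq R) i :
  regular_seq irrelevant (point_ideal X) s -> (N < i + size s)%N ->
  acyclic (fun l => 'X_l : R) (point_ideal X) i.
Proof.
move=> /(regular_seqP _ _ (ideal_point X)) [sm sI _] Ni.
apply: (acyclic_wreg (ideal_point X) _ sI) => // f /sm.
by move/irrelevant_xideal.
Qed.

(** R / I_X embeds into a finite product of polynomial rings in r variables. *)
Lemma regular_seq_size X (s : seq R) :
  regular_seq irrelevant (point_ideal X) s -> (size s <= r)%N.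
Proof.
move=> /(regular_seqP _ _ (ideal_point X)) [sm sI n1].
pose phi (Q : X) : {linear R -> {mpoly k[r]}} := pev vtag (pt (val Q)).
have phiI (f : R) : (forall Q : X, phi Q f = 0) -> point_ideal X f.
  by move=> f0; apply/point_idealP => Q QX; apply: (f0 [` QX]%fset).
have phid u (Q : X) (f : R) : degle u f -> degle u (phi Q f) by exact: degle_pev.
exact: (@regular_bound k N r X phi (point_ideal X) s (ideal_point X) phiI phid sI n1).
Qed.

Section Separator.
Variables (X : {fset mproj k n}) (P : mproj k n) (alpha : 'X_{1..r}) (F : R).
Hypothesis PX : P \in X.
Hypothesis F_sep : separator X P alpha F.
Hypothesis alpha_min : forall b, separator_deg X P b -> (alpha <= b)%MM.

Lemma separator_homog : {in msupp F, forall m, md vtag m = alpha}.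
Proof. by case: F_sep => Fa _ _ m /Fa; rewrite multidegE. Qed.

Lemma separator_pev :
  exists2 c : k, c != 0 & pev vtag (pt P) F = c *: 'X_[alpha].
Proof.
exists F.@[pt P]; last exact: pev_homog separator_homog.
case: F_sep => _ FP _; apply/eqP => F0; apply: FP.
by apply/(vanishes_pev _ separator_homog); rewrite (pev_homog _ separator_homog) F0 scale0r.
Qed.

Lemma separator_pev0 Q : Q \in (X `\ P)%fset -> pev vtag (pt Q) F = 0.
Proof. by case: F_sep => _ _ FQ /FQ /(vanishes_pev _ separator_homog). Qed.

(** F vanishes at the other points, and on the cone over P it is a nonzero
    multiple of a monomial, hence a nonzero divisor. *)
Lemma separator_colon g :
  pev vtag (pt P) g = 0 <-> point_ideal X (g * F).
Proof.
have [c c0 FE] := separator_pev; split=> [g0|/point_idealP /(_ P PX)].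
  apply/point_idealP => Q QX; rewrite rmorphM /=.
  have [->|QP] := eqVneq Q P; first by rewrite g0 mul0r.
  by rewrite separator_pev0 ?mulr0 // in_fsetD1 QP.
rewrite rmorphM /= FE => /eqP; rewrite mulf_eq0 => /orP [/eqP //|].
by rewrite scaler_eq0 (negPf c0) -msupp_eq0 msuppX.
Qed.

(** Every degree in which I_Y exceeds I_X is the degree of a separator, so on
    the cone over P the elements of I_Y are multiples of the monomial to which
    F restricts; a multiple of F corrects them to elements of I_X. *)
Lemma separator_adjoin f :
  adjoin (point_ideal X) F f <-> point_ideal (X `\ P)%fset f.
Proof.
have [c c0 FE] := separator_pev; split=> [[a /point_idealP fX]|/point_idealP fY].
  apply/point_idealP => Q QY; move: (QY); rewrite in_fsetD1 => /andP [_ /fX].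
  by rewrite rmorphB rmorphM /= separator_pev0 // mulr0 subr0.
have [piv [vtag_piv v_piv]] := pt_pivots P.
have le_supp b : b \in msupp (pev vtag (pt P) f) -> (alpha <= b)%MM.
  rewrite mcoeff_msupp mcoeff_pev => nz; apply: alpha_min.
  set g := mpart _ f in nz.
  have gb : {in msupp g, forall m, md vtag m = b} by move=> m /mpart_supp /eqP.
  exists g; split.
  - by move=> m /gb; rewrite multidegE.
  - move/(vanishes_pev _ gb); rewrite (pev_homog _ gb) => /eqP.
    by rewrite scaler_eq0 (negPf nz) -msupp_eq0 msuppX.
  - by move=> Q QY; apply/(vanishes_pev _ gb)/pev_mpart/fY.
have [g gE] : exists g, pev vtag (pt P) f = g * 'X_[alpha].
  set h := pev _ _ f in le_supp *.
  exists (\sum_(b <- msupp h) h@_b *: 'X_[b - alpha]).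
  rewrite {1}(mpolyE h) mulr_suml big_seq [RHS]big_seq; apply: eq_bigr => b bh.
  by rewrite -scalerAl -mpolyXD submK // le_supp.
exists (cone_lift (pt P) piv (c^-1 *: g)).
apply/point_idealP => Q QX; rewrite rmorphB rmorphM /=.
have [->|QP] := eqVneq Q P.
  rewrite cone_liftK // FE gE -scalerAl -scalerAr scalerA mulVf // scale1r.
  by rewrite subrr.
have QY : Q \in (X `\ P)%fset by rewrite in_fsetD1 QP.
by rewrite fY // separator_pev0 // mulr0 subr0.
Qed.

End Separator.

(** Descending from a separator degree one reaches a minimal one, and alpha is
    the only one. *)
Lemma separator_min X P alpha :
  (forall a, deg_point X P a <-> a = alpha) ->
  forall b, separator_deg X P b -> (alpha <= b)%MM.
Proof.
move=> ha b; move: {2}(mdeg b) (leqnn (mdeg b)) => u.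
elim: u b => [|u IHu] b bu sb.
  suff /ha <- : deg_point X P b by exact: lepm_refl.
  split=> // c _ cb; apply/mnmP => i; apply/eqP.
  have bi : b i = 0%N.
    by apply/eqP; rewrite -leqn0 (leq_trans _ bu) // mdegE (bigD1 i) //= leq_addr.
  by have /mnm_lepP /(_ i) := cb; rewrite bi leqn0.
have [[c [sc cb ne]]|no] := classic (exists c, [/\ separator_deg X P c, (c <= b)%MM & c <> b]).
  apply: (lepm_trans _ cb); apply: IHu => //; rewrite -ltnS; apply: leq_trans bu.
  rewrite -(submK cb) mdegD addnC -{1}[mdeg c]addn0 ltn_add2l lt0n mdeg_eq0.
  by apply/eqP => E; apply: ne; rewrite -(submK cb) E add0m.
suff /ha <- : deg_point X P b by exact: lepm_refl.
split=> // c sc cb; apply: NNPP => ne; apply: no; by exists c.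
Qed.

End Points.

(** * Removing a point *)
Section RemovePoint.
Variables (k : fieldType) (r : nat) (n : 'I_r -> nat).
Local Notation N := #|mvar n|.
Local Notation R := {mpoly k[N]}.
Local Notation t := (\sum_(i < r) n i)%N.
Variables (X : {fset mproj k n}) (P : mproj k n) (alpha : 'X_{1..r}) (F : R).
Local Notation Y := (X `\ P)%fset.
Hypothesis r_gt0 : (0 < r)%N.
Hypothesis PX : P \in X.
Hypothesis F_sep : separator X P alpha F.
Hypothesis alpha_min : forall b, separator_deg X P b -> (alpha <= b)%MM.
Local Notation vt := (@vtag r n).
Local Notation acycX := (acyclic (fun l => 'X_l : R)).

Lemma card_mvar : N = (t + r)%N.
Proof. exact: card_vars (@card_vtag r n). Qed.

(** R / I_X has depth r and so has its submodule R / I_P; the quotient R / I_Y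
    can lose one. *)
Lemma removed_acyclic (s : seq R) i :
  regular_seq irrelevant (point_ideal X) s -> size s = r ->
  (N < i + r.-1)%N -> acycX (point_ideal Y) i.
Proof.
move=> sX sr Ni; apply: (@acyclic_ext R N (fun l => 'X_l) (adjoin (point_ideal X) F)) => [g|].
  exact: (separator_adjoin F_sep alpha_min g).
have [piv [vtag_piv v_piv]] := pt_pivots P.
(* Degree 0 does not occur, since N = t + r exceeds r - 1. *)
case: i Ni => [|i] Ni; first by exfalso; have := card_mvar; lia.
apply: (acyclic_adjoin (ideal_point X) (separator_colon PX F_sep)).
  by apply: regular_seq_acyclic sX _; rewrite sr; lia.
by apply: (pev_acyclic vtag_piv v_piv); lia.
Qed.

Lemma removed_depth (s : seq R) :
  regular_seq irrelevant (point_ideal X) s -> size s = r ->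
  ~ is_ACM Y -> has_depth irrelevant (point_ideal Y) r.-1.
Proof.
move=> sX sr nY; have [Y0|[Q QY]] := fset_0Vmem Y; first by case: nY; left.
have [|s' s'r [s'm s'Y]] := @acyclic_regular R N (fun l => 'X_l) r.-1
  (@noetherian_mpoly k N) (point_ideal Y) (ideal_point Y).
  by move=> i; apply: removed_acyclic sX sr.
have s'irr : {in s', forall f, irrelevant (n := n) f}.
  by move=> f /s'm /irrelevant_xideal.
split.
  exists s' => //; apply/regular_seqP; first exact: ideal_point.
  by split=> //; apply: point_ideal_proper QY s'irr.
(* A regular sequence of length r would make Y ACM. *)
move=> u uY; have := regular_seq_size uY; rewrite leq_eqVlt.
move=> /orP [/eqP ur|ur]; last by rewrite -ltnS prednK.
case: nY; right; split; first by exists u.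
by move=> u' /regular_seq_size.
Qed.

(** The exterior product of the linear forms that generate I_P is a Koszul cycle
    modulo I_P, and its coefficient at the set of non-pivots is a sign, hence
    not in I_P + (x), as [last_shift] requires. *)
Lemma removed_shift (S : nat -> seq 'X_{1..r})
    (d : forall s, 'M[mring k n]_(size (S s.+1), size (S s))) :
  min_graded_free_resolution (point_ideal X) t d -> is_ACM Y ->
  (alpha + [multinom n i | i < r])%MM \in S t.
Proof.
move=> hres Y_ACM; have [piv [vtag_piv v_piv]] := pt_pivots P.
set ls := nonpivots vt piv.
have lst : size ls = t := size_nonpivots vtag_piv (@card_vtag r n).
have lsn : (\sum_(l <- ls) U_(vt l))%MM = [multinom n i | i < r] :=
  sum_nonpivots vtag_piv (@card_vtag r n).
have aY : acycX (point_ideal Y) t.+1.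
  case: Y_ACM => [Y0|[[s sY sr] _]]; last first.
    by apply: regular_seq_acyclic sY _; rewrite sr card_mvar addSn.
  move=> w _ _; exists 0; first by move=> T _; rewrite ffunE.
  by move=> T; apply/point_idealP => Q; rewrite Y0 inE.
pose a := cone_form vt (pt P) piv.
pose z := wedge a ls.
have [e zlead] : exists e : nat, z [set l in ls] = (-1) ^+ e.
  apply: wedge_lead; first by rewrite filter_uniq // enum_uniq.
  exact: cone_form_lead.
apply: (@last_shift R N r (fun l => 'X_l) (fun l => U_(vt l)%MM) (mdpart vt)
  (@mdpartB _ _ _ _) (@mdpartK _ _ _ _) (@mdpart_x _ _ _ _) (@mdpart_neq _ _ _ _)
  (@acyclic_vars k N) t S d _ (res_exact hres) (res_start hres)
  (point_ideal X) (ideal_point X) (res_exact0 hres)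
  (fun g => pev vt (pt P) g = 0) F _ z [set l in ls]).
- move=> beta s sigma f i j; apply: mpartM => m /(res_graded hres) <- m'.
  by rewrite multidegE mdD; congr (_ == _); apply/mnmP => b; rewrite !mnmDE; lia.
- exact: pev_ideal.
- exact: (separator_colon PX F_sep).
- by apply: acyclic_ext aY => g; split=> /(separator_adjoin F_sep alpha_min).
- by rewrite -lst; apply: wedge_deg.
- apply: wedge_cycle; first exact: pev_ideal.
  by move=> l; rewrite mem_filter => /andP [lp _]; apply: cone_form_vanish.
- rewrite -lsn; apply: hp_wedge; first exact: mdpartB.
    by apply: mpart_id => m /(separator_homog F_sep) ->; rewrite addm0.
  by move=> l m beta sigma f _; apply: mdpart_cone_form.
- move=> g /xideal_vars g0 /(congr1 (mcoeff 0%MM)); rewrite mcoeff0_pev mcoeff0 zlead.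
  rewrite mcoeffB g0 subr0 rmorphXn rmorphN1 => /eqP.
  by rewrite signr_eq0.
Qed.

End RemovePoint.

Theorem theorem3p2 (k : closedFieldType) (r : nat) (n : 'I_r -> nat)
    (X : {fset mproj k n}) (P : mproj k n) (alpha : 'X_{1..r}) :
  [pchar k] =i pred0 ->
  (0 < r)%N -> (forall i, (0 < n i)%N) ->
  is_ACM X ->
  P \in X ->
  (forall a, deg_point X P a <-> a = alpha) ->
  (forall (S : nat -> seq 'X_{1..r})
      (d : forall s, 'M[mring k n]_(size (S s.+1), size (S s))),
    min_graded_free_resolution (point_ideal X) (\sum_(i < r) n i)%N d ->
    is_ACM (X `\ P)%fset ->
    (alpha + [multinom n i | i < r])%MM \in S (\sum_(i < r) n i)%N) /\
  (~ is_ACM (X `\ P)%fset ->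
    has_depth irrelevant (point_ideal (X `\ P)%fset) r.-1).
Proof.
move=> _ r0 _ X_ACM PX ha.
have [F F_sep] : separator_deg X P alpha by have [] := proj2 (ha alpha) erefl.
have alpha_min := separator_min ha.
have [s sX sr] : exists2 s, regular_seq irrelevant (point_ideal X) s & size s = r.
  by case: X_ACM => [X0|[]] //; rewrite X0 inE in PX.
split=> [S d hres Y_ACM|nY].
  exact: removed_shift PX F_sep alpha_min S d hres Y_ACM.
exact: removed_depth PX F_sep alpha_min s sX sr nY.
Qed.
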